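(* Let $J\subseteq I$, $\nu\in\Lambda_J^\vee$, and let $W$ be a highest $\ell$-weight $U_q^\nu(\mathfrak g_J)$-module. Let $\mu\in\Lambda^\vee$ with $\mathrm{res}_J(\mu)=\nu$ and suppose that $V$ is a $J$-inflation of $W$ to $\mathfrak g$ with coweight $\mu$. Then $\mathrm{rad}\,V$ and $\mathrm{top}\,V$ are $J$-inflations to $\mathfrak g$ (with coweight $\mu$) of $\mathrm{rad}\,W$ and $\mathrm{top}\,W$, respectively.
   Context: Setup. Everything is over $\mathbb C$; $\mathbb N=\mathbb Z_{\ge 0}$. $\mathfrak g$ is a finite-dimensional simple Lie algebra with Dynkin index set $I=\{1,\dots,n\}$ and Cartan matrix $C=(C_{i,j})_{i,j\in I}$; $d_1,\dots,d_n$ are the relatively prime positive integers such that $(d_iC_{i,j})$ is symmetric. $\alpha_i,\omega_i,\omega_i^\vee$ are the simple roots, fundamental weights and fundamental coweights (so $\alpha_i(\omega_j^\vee)=\delta_{i,j}$ and $\alpha_i=\sum_jC_{j,i}\omega_j$), and $\Lambda^\vee=\bigoplus_{i\in I}\mathbb Z\omega_i^\vee$. $q\in\mathbb C^\times$ is not a root of unity and $q_i=q^{d_i}$. For $J\subseteq I$, $\mathfrak g_J$ is the semisimple Lie algebra with Cartan matrix $(C_{i,j})_{i,j\in J}$, $Q_J^+=\bigoplus_{j\in J}\mathbb N\alpha_j$, $\Lambda_J^\vee=\bigoplus_{j\in J}\mathbb Z\omega_j^\vee\subseteq\Lambda^\vee$, and $\mathrm{res}_J:\Lambda^\vee\to\Lambda_J^\vee$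 is the projection. Algebras. For $J\subseteq I$ and $\nu\in\Lambda_J^\vee$, $U_q^\nu(\mathfrak g_J)$ is the unital algebra generated by $x_{i,r}^\pm,\phi_{i,r}^\pm$ ($i\in J$, $r\in\mathbb Z$), with $\phi_{i,0}^+$ and $\phi^-_{i,\alpha_i(\nu)}$ invertible, and relations (for $i,j\in J$, $r,s\in\mathbb Z$, $m\in\mathbb Z\setminus\{0\}$): all the $\phi^{\pm}_{i,r}$ commute with each other; $\phi_{i,0}^+x_{j,r}^\pm=q_i^{\pm C_{i,j}}x_{j,r}^\pm\phi_{i,0}^+$; $\phi_{i,\alpha_i(\nu)}^-x_{j,r}^\pm=q_i^{\mp C_{i,j}}x_{j,r}^\pm\phi_{i,\alpha_i(\nu)}^-$; $[h_{i,m},x_{j,r}^\pm]=\pm\frac1m[mC_{i,j}]_{q_i}x_{j,m+r}^\pm$; $(q_i-q_i^{-1})[x_{i,r}^+,x_{j,s}^-]=\delta_{i,j}(\phi_{i,r+s}^+-\phi_{j,r+s}^-)$; $x_{i,r+1}^\pm x_{j,s}^\pm-q_i^{\pm C_{i,j}}x_{j,s}^\pm x_{i,r+1}^\pm=q_i^{\pm C_{i,j}}x_{i,r}^\pm x_{j,s+1}^\pm-x_{j,s+1}^\pm x_{i,r}^\pm$; and, for $i\ne j$, $p=1-C_{i,j}$ and $r',r_1,\dots,r_p\in\mathbb Z$, $\sum_{\pi\in\Sigma_p}\sum_{\ell=0}^p(-1)^\ell\frac{[p]_{q_i}!}{[\ell]_{q_i}![p-\ell]_{q_i}!}x^\pm_{i,r_{\pi(1)}}\cdots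 x^\pm_{i,r_{\pi(\ell)}}x^\pm_{j,r'}x^\pm_{i,r_{\pi(\ell+1)}}\cdots x^\pm_{i,r_{\pi(p)}}=0$. Here $[m]_x=\frac{x^m-x^{-m}}{x-x^{-1}}$, $[m]_x!=\prod_{r=1}^m[r]_x$, and the $h_{i,m}$ are defined by $\sum_{r\in\mathbb Z}\phi^\pm_{i,\pm r}z^{\pm r}=z^{\nu(i,\pm)}\phi^\pm_{i,\nu(i,\pm)}\exp\big(\pm(q_i-q_i^{-1})\sum_{m>0}h_{i,\pm m}z^{\pm m}\big)$ with $\nu(i,+)=0$, $\nu(i,-)=\alpha_i(\nu)$ (so $\phi_{i,r}^+=0$ for $r<0$ and $\phi_{i,r}^-=0$ for $r>\alpha_i(\nu)$). Currents: $x_i^\pm(z)=\sum_{r}x_{i,r}^\pm z^r$, $\phi_i^\pm(z)=\sum_r\phi_{i,r}^\pm z^r$. For $J=I$ this is the shifted quantum affine algebra $U_q^\mu(\mathfrak g)$, $\mu\in\Lambda^\vee$. If $\mathrm{res}_J(\mu)=\nu$, identifying generators with the same name gives an embedding $U_q^\nu(\mathfrak g_J)\hookrightarrow U_q^\mu(\mathfrak g)$, and $\mathrm{res}_J^\mu$ denotes the corresponding restriction functor. Category $\mathcal O$. Let $\mathfrak t_J^\times=(\mathbb C^\times)^J$, ordered by: $\gamma\le\gamma'$ iff $\gamma'\gamma^{-1}=\big(\prod_{i\in J}q_j^{a_iC_{j,i}}\big)_{j\in J}$ for some $\sum_{i\in J} a_i\alpha_i\in Q_J^+$. For a $U_q^\nu(\mathfrak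 g_J)$-module $V$ and $\gamma\in\mathfrak t_J^\times$ let $V_\gamma=V_\gamma^+=\{v:\phi_{i,0}^+v=\gamma_iv\ \forall i\in J\}$, $V_\gamma^-=\{v:\phi_{i,\alpha_i(\nu)}^-v=\gamma_i^{-1}v\ \forall i\in J\}$, $P(V)=\{\gamma:V_\gamma\ne0\}$, $P^-(V)=\{\gamma:V_\gamma^-\neq0\}$. $\mathcal O_J^\nu$ is the full subcategory of $U_q^\nu(\mathfrak g_J)$-modules $V$ with $V=\bigoplus_\gamma V_\gamma=\bigoplus_\gamma V_\gamma^-$, $\dim V_\gamma^\pm<\infty$ for all $\gamma$, and $P(V)\cup P^-(V)\subseteq\bigcup_{i=1}^s\{\gamma:\gamma\le\lambda_i\}$ for some $\lambda_1,\dots,\lambda_s\in\mathfrak t_J^\times$. $\mathcal O^\mu=\mathcal O_I^\mu$. Highest $\ell$-weight modules. A highest $\ell$-weight $U_q^\nu(\mathfrak g_J)$-module is an object of $\mathcal O_J^\nu$ generated by some $v\ne0$ with $x_j^+(z)v=0$ and $\phi_j^\pm(z)v=\Psi_j(z)v$ for all $j\in J$, where $\Psi=(\Psi_j(z))_{j\in J}$ is a tuple of rational functions regular and nonzero at $z=0$ (expanded at $z=0$ for $+$, at $z=\infty$ for $-$). Radical and top. $\mathrm{rad}\,V$ is the Jacobson radical (intersection of all maximal proper submodules) of a module $V$, and $\mathrm{top}\,V=V/\mathrm{rad}\,V$ is its head. Inflation. Let $W$ be an object of $\mathcal O_J^\nu$, $\mathrm{res}_J(\mu)=\nu$ and $V$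 an object of $\mathcal O^\mu$. $V$ is a $J$-inflation of $W$ to $\mathfrak g$ with coweight $\mu$ if (i) $\mathrm{res}_J^\mu(V)\simeq W$ as $U_q^\nu(\mathfrak g_J)$-modules and (ii) $x_i^\pm(z) V=0$ for all $i\in I\setminus J$. *)

(* Defs.v *)
From HB Require Import structures.
From mathcomp Require Import all_boot all_order all_algebra all_fingroup.
From mathcomp Require Import generic_quotient ring_quotient fraction.
From mathcomp Require Import boolp reals complex monalg.

Set Implicit Arguments.
Unset Strict Implicit.
Unset Printing Implicit Defensive.

Import Order.TTheory GRing.Theory Num.Theory.
Local Open Scope ring_scope.

Record cartan_datum := CartanDatum {
  dindex :> finType;
  dmat : dindex -> dindex -> int;
  dsym : dindex -> nat
}.

Definition matrix_datum n (A : 'M[int]_n) (d : 'I_n -> nat) : cartan_datum :=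
  @CartanDatum 'I_n A d.

Definition subdatum (D : cartan_datum) (J : {set D}) : cartan_datum :=
  @CartanDatum {j : D | j \in J}
    (fun i j => dmat (val i) (val j)) (fun i => dsym (val i)).

(* Complex finite-dimensional simple Lie algebras are in bijection (up to
   isomorphism) with the indecomposable Cartan matrices of finite type, and
   enter only through that matrix; [d] is the primitive symmetrizer. *)
Record simple_cartan (R : realFieldType) n (A : 'M[int]_n) (d : 'I_n -> nat)
    : Prop := SimpleCartan {
  cartan_rank_gt0 : (0 < n)%N;
  cartan_diag : forall i, A i i = 2;
  cartan_offdiag : forall i j, i != j -> A i j <= 0;
  cartan_sym_gt0 : forall i, (0 < d i)%N;
  cartan_sym_prime : \big[gcdn/0%N]_i d i = 1%N;
  cartan_sym : forall i j, (d i)%:Z * A i j = (d j)%:Z * A j i;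
  cartan_posdef : forall u : 'I_n -> R, (exists i, u i != 0) ->
    0 < \sum_i \sum_j u i * ((d i)%:Z * A i j)%:~R * u j;
  cartan_indec : forall S : {set 'I_n}, S != set0 -> S != setT ->
    exists i j, [/\ i \in S, j \notin S & A i j != 0]
}.

Section MalgTheory.
Variables (K : comNzRingType) (M : monomType).
Implicit Types f g : {malg K[M]}.

Lemma malgU_scale (a c : K) (k : M) :
  a *: mkmalgU k c = mkmalgU k (a * c) :> {malg K[M]}.
Proof. by apply/malgP => l; rewrite mcoeffZ !mcoeffU mulrnAr. Qed.

Lemma malgU_mul (a c : K) (k l : M) :
  mkmalgU k a * mkmalgU l c = mkmalgU (mmul k l) (a * c) :> {malg K[M]}.
Proof. by rewrite malgM_def fgmulUU. Qed.

Fact malg_scalerAr (a : K) f g : a *: (f * g) = f * (a *: g).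
Proof.
rewrite [f]monalgE !mulr_suml scaler_sumr; apply: eq_bigr => k _.
rewrite [g]monalgE mulr_sumr !scaler_sumr mulr_sumr; apply: eq_bigr => l _.
by rewrite (malgU_scale a) !malgU_mul malgU_scale mulrCA.
Qed.

End MalgTheory.

(* The free K-algebra on G; the library only declares monoid algebras of
   noncommutative monoids as left algebras. *)
Definition free_malg (K : fieldType) (G : choiceType) : Type :=
  {malg K[{fmonom G}]}.

HB.instance Definition _ (K : fieldType) (G : choiceType) :=
  GRing.Lalgebra.copy (free_malg K G) {malg K[{fmonom G}]}.

HB.instance Definition _ (K : fieldType) (G : choiceType) :=
  GRing.Lalgebra_isAlgebra.Build K (free_malg K G)
    (@malg_scalerAr K {fmonom G}).

Section FreeMalg.
Variables (K : fieldType) (G : choiceType).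

Definition fmalg_gen (g : G) : free_malg K G := mkmalgU (fmu g) 1.

Fact fmalg_ind (P : free_malg K G -> Prop) :
  P 1 -> (forall g, P (fmalg_gen g)) ->
  (forall a f, P f -> P (a *: f)) ->
  (forall f g, P f -> P g -> P (f + g)) ->
  (forall f g, P f -> P g -> P (f * g)) ->
  forall f, P f.
Proof.
move=> P1 Pg PZ PD PM f; rewrite [f]monalgE.
elim/big_ind: _ => [||k _]; [by rewrite -(scale0r 1); exact: PZ | exact: PD |].
rewrite -[f@_k]mulr1 -malgU_scale; apply: PZ.
case: k => s; elim: s => [|g s IH].
  by have -> : FMonom [::] = mone :> {fmonom G} by exact: esym (fmoneE G).
have -> : FMonom (g :: s) = mmul (fmu g) (FMonom s) :> {fmonom G}.
  by rewrite -[RHS]/(fmmul (fmu g) (FMonom s)) fmmulE fmuE.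
by rewrite -[1]mulr1 -malgU_mul; apply: PM => //; exact: Pg.
Qed.

Variables (A : algType K) (h : G -> A).

Definition fmalg_mon (m : {fmonom G}) : A := \prod_(g <- m) h g.

Fact fmalg_mon_mmorphism : mmorphism fmalg_mon.
Proof.
split=> [m1 m2|]; last by rewrite /fmalg_mon fm1 big_nil.
by rewrite /fmalg_mon fmM big_cat.
Qed.

HB.instance Definition _ :=
  isMultiplicative.Build {fmonom G} A fmalg_mon fmalg_mon_mmorphism.

Definition fmalg_map (f : free_malg K G) : A :=
  mmap (GRing.in_alg A) fmalg_mon f.

Fact fmalg_map_additive : zmod_morphism fmalg_map.
Proof. by move=> f g; exact: (raddfB (mmap (GRing.in_alg A) fmalg_mon)). Qed.

HB.instance Definition _ :=
  GRing.isZmodMorphism.Build (free_malg K G) A fmalg_map fmalg_map_additive.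

Fact fmalg_map_multiplicative : monoid_morphism fmalg_map.
Proof.
have [HM H1] : multiplicative (mmap (GRing.in_alg A) fmalg_mon).
  apply: commr_mmap_is_multiplicative => f m m'.
  by rewrite /GRing.comm /= mulr_algl mulr_algr.
by split; [exact: H1 | exact: HM].
Qed.

HB.instance Definition _ :=
  GRing.isMonoidMorphism.Build (free_malg K G) A fmalg_map
    fmalg_map_multiplicative.

Fact fmalg_map_scalable : scalable fmalg_map.
Proof. by move=> a f; rewrite /fmalg_map mmapZ /= mulr_algl. Qed.

HB.instance Definition _ :=
  GRing.isScalable.Build K (free_malg K G) A *:%R fmalg_map fmalg_map_scalable.

Fact fmalg_map_gen g : fmalg_map (fmalg_gen g) = h g.
Proof.
by rewrite /fmalg_map /fmalg_gen mmapU /= scale1r mul1r /fmalg_mon fmU big_seq1.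
Qed.

End FreeMalg.

(* A free algebra on G, i.e. an algebra with its universal property, which
   determines it up to unique isomorphism. *)
Record free_algebra (K : fieldType) (G : choiceType) := FreeAlgebra {
  free_sort : algType K;
  free_sort_gen : G -> free_sort;
  free_lift : forall A : algType K, (G -> A) -> {lrmorphism free_sort -> A};
  free_lift_gen : forall (A : algType K) (h : G -> A) g,
    free_lift h (free_sort_gen g) = h g;
  free_gen_ind : forall P : free_sort -> Prop,
    P 1 -> (forall g, P (free_sort_gen g)) ->
    (forall a f, P f -> P (a *: f)) ->
    (forall f g, P f -> P g -> P (f + g)) ->
    (forall f g, P f -> P g -> P (f * g)) ->
    forall f, P f
}.

(* Opaque on purpose: it keeps unification from computing with finitely
   supported functions on words, and only the universal property matters. *)
Fact free_algebra_exists (K : fieldType) (G : choiceType) : free_algebra K G.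
Proof.
exact: (@FreeAlgebra K G (free_malg K G) (@fmalg_gen K G)
  (fun A h => fmalg_map h) (@fmalg_map_gen K G) (@fmalg_ind K G)).
Qed.

Definition free_alg (K : fieldType) (G : choiceType) : algType K :=
  free_sort (free_algebra_exists K G).

Definition free_gen (K : fieldType) (G : choiceType) : G -> free_alg K G :=
  @free_sort_gen K G (free_algebra_exists K G).

Definition free_map (K : fieldType) (G : choiceType) (A : algType K) (h : G -> A)
    : {lrmorphism free_alg K G -> A} :=
  free_lift (free_algebra_exists K G) h.

Lemma free_map_gen (K : fieldType) (G : choiceType) (A : algType K) (h : G -> A) g :
  free_map h (free_gen K g) = h g.
Proof. exact: free_lift_gen. Qed.

Lemma free_ind (K : fieldType) (G : choiceType) (P : free_alg K G -> Prop) :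
  P 1 -> (forall g, P (free_gen K g)) ->
  (forall a f, P f -> P (a *: f)) ->
  (forall f g, P f -> P g -> P (f + g)) ->
  (forall f g, P f -> P g -> P (f * g)) ->
  forall f, P f.
Proof. exact: free_gen_ind. Qed.

Section Series.
Variables (K : fieldType) (A : lalgType K).
Implicit Types a b : nat -> A.

Definition cauchy a b n : A := \sum_(i < n.+1) a i * b (n - i)%N.

Fixpoint ser_exp a k : nat -> A :=
  if k is k'.+1 then cauchy a (ser_exp a k') else fun n => (n == 0%N)%:R.

(* Coefficient of z^n in exp(\sum_(m > 0) a_m z^m); only meaningful when
   a_0 = 0, in which case the k-th power has no term of degree n < k. *)
Definition exp_coef a n : A := \sum_(k < n.+1) (k`!%:R)^-1 *: ser_exp a k n.

(* The unique a with a_0 = 0 and exp(\sum_(m > 0) a_m z^m) equal to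
   1 + \sum_(n > 0) b_n z^n: the coefficient of z^n in the exponential is the
   sum of a_n and of an expression in a_1, ..., a_(n-1), so that one can
   solve for a_n. *)
Fixpoint log_seq b n : seq A :=
  if n is n'.+1
  then let s := log_seq b n' in rcons s (b n - exp_coef (nth 0 s) n)
  else [:: 0].

Definition log_coef b n : A := nth 0 (log_seq b n) n.

Lemma size_log_seq b n : size (log_seq b n) = n.+1.
Proof. by elim: n => //= n IH; rewrite size_rcons IH. Qed.

Lemma nth_log_seq b n k : (k <= n)%N -> nth 0 (log_seq b n) k = log_coef b k.
Proof.
elim: n => [|n IH]; first by rewrite leqn0 => /eqP ->.
rewrite leq_eqVlt => /orP[/eqP -> //|kn].
by rewrite /= nth_rcons size_log_seq kn IH.
Qed.

Lemma eq_ser_exp a b k m n :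
  a 0%N = 0 -> b 0%N = 0 -> (m <= n)%N ->
  (forall i, (i < n)%N -> a i = b i) ->
  (k != 1 \/ m < n)%N -> ser_exp a k m = ser_exp b k m.
Proof.
move=> a0 b0; elim: k m n => [//|k IH] m n mn ab km /=.
rewrite /cauchy; apply: eq_bigr => -[i /= im] _.
case: (posnP i) => [-> | i0]; first by rewrite a0 b0 !mul0r.
case: k IH km => [|k] IH km.
  by case: km => // mn'; rewrite ab // (leq_ltn_trans _ mn') // -ltnS.
have [im'|im'] := ltnP i m; last first.
  have -> : i = m by apply/eqP; rewrite eqn_leq im' -ltnS im.
  by rewrite subnn /= /cauchy !big_ord1 a0 b0 !mul0r !mulr0.
rewrite ab ?(leq_trans im' mn) // (IH (m - i)%N n) //.
  exact: leq_trans (leq_subr _ _) mn.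
by right; apply: leq_trans mn; rewrite ltn_subrL i0 (leq_trans _ im').
Qed.

Lemma ser_exp1 a n : ser_exp a 1 n = a n.
Proof.
rewrite /= /cauchy big_ord_recr /= subnn eqxx mulr1 big1 ?add0r // => i _.
by rewrite subn_eq0 leqNgt ltn_ord mulr0.
Qed.

Lemma log_coef0 b : log_coef b 0 = 0.
Proof. by []. Qed.

Lemma exp_log b n : (0 < n)%N -> exp_coef (log_coef b) n = b n.
Proof.
case: n => // n _.
pose s := nth 0 (log_seq b n).
have sE i : (i < n.+1)%N -> log_coef b i = s i.
  by move=> i_n; rewrite -(nth_log_seq b (n := n)).
have eqs k : k != 1%N -> ser_exp (log_coef b) k n.+1 = ser_exp s k n.+1.
  move=> k1; apply: (@eq_ser_exp _ _ _ _ n.+1) => //; last by left.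
  by rewrite /s nth_log_seq.
have lE : log_coef b n.+1 = b n.+1 - exp_coef s n.+1.
  by rewrite /log_coef /= nth_rcons size_log_seq ltnn eqxx.
have sn0 : s n.+1 = 0 by rewrite /s nth_default // size_log_seq.
suff -> : exp_coef (log_coef b) n.+1 = exp_coef s n.+1 + log_coef b n.+1.
  by rewrite lE addrC subrK.
pose one := Ordinal (isT : (1 < n.+2)%N).
rewrite /exp_coef (bigD1 one) // [in RHS](bigD1 one) //=.
rewrite invr1 !scale1r -!/(ser_exp _ 1 _) !ser_exp1 sn0 add0r addrC.
by congr (_ + _); apply: eq_bigr => k k1; rewrite eqs.
Qed.

End Series.

(* [true] stands for the sign +, [false] for the sign -. *)
Definition sgn (b : bool) : int := if b then 1 else -1.

(* [GPhiInv true i] and [GPhiInv false i] are the inverses of phi^+_(i,0) and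
   phi^-_(i,alpha_i(nu)) respectively. *)
Inductive gen (D : Type) :=
  | GX of bool & D & int
  | GPhi of bool & D & int
  | GPhiInv of bool & D.

Section GenChoice.
Variable D : choiceType.

Definition gen_code (g : gen D) : (bool * D * int) + (bool * D * int) + (bool * D) :=
  match g with
  | GX b i r => inl (inl (b, i, r))
  | GPhi b i r => inl (inr (b, i, r))
  | GPhiInv b i => inr (b, i)
  end.

Definition gen_decode (c : (bool * D * int) + (bool * D * int) + (bool * D)) : gen D :=
  match c with
  | inl (inl (b, i, r)) => GX b i r
  | inl (inr (b, i, r)) => GPhi b i r
  | inr (b, i) => GPhiInv b i
  end.

Lemma gen_codeK : cancel gen_code gen_decode.
Proof. by case. Qed.

HB.instance Definition _ := Choice.copy (gen D) (can_type gen_codeK).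

End GenChoice.

Definition quantum_int (K : fieldType) (x : K) (m : int) : K :=
  (x ^ m - x ^ (- m)) / (x - x^-1).

Definition quantum_fact (K : fieldType) (x : K) (m : nat) : K :=
  \prod_(1 <= r < m.+1) quantum_int x r%:Z.

Definition quantum_binom (K : fieldType) (x : K) (p l : nat) : K :=
  quantum_fact x p / (quantum_fact x l * quantum_fact x (p - l)).

(* An element of the coweight lattice is given by its coordinates in the basis
   of fundamental coweights, so that alpha_i(nu) is [nu i]. *)
Definition coweight (D : cartan_datum) := {ffun D -> int}.

Definition res_coweight (D : cartan_datum) (J : {set D}) (mu : coweight D)
    : coweight (subdatum J) :=
  [ffun j => mu (val j)].

Section Presentation.
Variables (K : fieldType) (q : K) (D : cartan_datum) (nu : coweight D).

Local Notation F := (free_alg K (gen D)).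
Implicit Types (b c : bool) (i j : D) (r s m : int).

Definition qpar i : K := q ^+ dsym i.

Definition fx b i r : F := free_gen K (GX b i r).
Definition fphi b i r : F := free_gen K (GPhi b i r).
Definition fphiV b i : F := free_gen K (GPhiInv b i).

(* nu(i,+) and nu(i,-) *)
Definition lead b i : int := if b then 0 else nu i.

(* The series phi^(+/-)_i(z) divided by its leading term. *)
Definition fpsi b i (n : nat) : F := fphiV b i * fphi b i (lead b i + sgn b * n%:Z).

Definition fh i m : F :=
  ((sgn (0 < m))%:~R / (qpar i - (qpar i)^-1)) *: log_coef (fpsi (0 < m) i) `|m|%N.

Definition fcomm (f g : F) : F := f * g - g * f.

Definition serre_lhs b i j (s : int) p (r : 'I_p -> int) : F :=
  \sum_(t : 'S_p) \sum_(l < p.+1)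
    ((-1) ^+ l * quantum_binom (qpar i) p l) *:
      ((\prod_(k < p | (k < l)%N) fx b i (r (t k))) * fx b j s *
       (\prod_(k < p | (l <= k)%N) fx b i (r (t k)))).

(* [defrel f g] : the equality f = g is one of the defining relations. *)
Inductive defrel : F -> F -> Prop :=
| RelSuppP i r : r < 0 -> defrel (fphi true i r) 0
| RelSuppN i r : nu i < r -> defrel (fphi false i r) 0
| RelInvL b i : defrel (fphiV b i * fphi b i (lead b i)) 1
| RelInvR b i : defrel (fphi b i (lead b i) * fphiV b i) 1
| RelPhiPhi b c i j r s : defrel (fphi b i r * fphi c j s) (fphi c j s * fphi b i r)
| RelPhiX b c i j r :
    defrel (fphi b i (lead b i) * fx c j r)
           (qpar i ^ (sgn b * sgn c * dmat i j) *: (fx c j r * fphi b i (lead b i)))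
| RelHX b i j m r : m != 0 ->
    defrel (fcomm (fh i m) (fx b j r))
           (((sgn b)%:~R / m%:~R * quantum_int (qpar i) (m * dmat i j)) *:
              fx b j (m + r))
| RelXX i j r s :
    defrel ((qpar i - (qpar i)^-1) *: fcomm (fx true i r) (fx false j s))
           ((i == j)%:R *: (fphi true i (r + s) - fphi false j (r + s)))
| RelQuad b i j r s :
    defrel (fx b i (r + 1) * fx b j s
              - qpar i ^ (sgn b * dmat i j) *: (fx b j s * fx b i (r + 1)))
           (qpar i ^ (sgn b * dmat i j) *: (fx b i r * fx b j (s + 1))
              - fx b j (s + 1) * fx b i r)
| RelSerre b i j s (r : 'I_(`|1 - dmat i j|%N) -> int) : i != j ->
    defrel (serre_lhs b i j s r) 0.

Inductive relideal : F -> Prop :=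
| RelIdealRel f g : defrel f g -> relideal (f - g)
| RelIdeal0 : relideal 0
| RelIdealB f g : relideal f -> relideal g -> relideal (f - g)
| RelIdealMl f g : relideal g -> relideal (f * g)
| RelIdealMr f g : relideal f -> relideal (f * g).

Definition relideal_pred : {pred F} := fun f => `[< relideal f >].

Fact relideal_zmod_closed : zmod_closed relideal_pred.
Proof.
split=> [|f g /asboolP If /asboolP Ig]; apply/asboolP; first exact: RelIdeal0.
exact: RelIdealB.
Qed.

HB.instance Definition _ :=
  GRing.isZmodClosed.Build F relideal_pred relideal_zmod_closed.

Definition relideal_closed : zmodClosed F := relideal_pred.

Definition uqaff : Type := Quotient.quot relideal_closed.

HB.instance Definition _ := GRing.Zmodule.on uqaff.

Definition uq_pi : F -> uqaff := \pi_(Quotient.quot relideal_closed)%qT.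

Lemma uq_piP f g : uq_pi f = uq_pi g <-> relideal (f - g).
Proof.
rewrite /uq_pi; split=> [/eqP|H]; last apply/eqP.
  by rewrite -Quotient.idealrBE => /asboolP.
by rewrite -Quotient.idealrBE; apply/asboolP.
Qed.

Fact uq_pi_additive : zmod_morphism uq_pi.
Proof. by move=> f g; rewrite /uq_pi raddfB. Qed.

HB.instance Definition _ :=
  GRing.isZmodMorphism.Build F uqaff uq_pi uq_pi_additive.

Lemma uq_pi_surj (u : uqaff) : exists f, u = uq_pi f.
Proof. by exists (repr u); rewrite /uq_pi reprK. Qed.

Definition uq_one : uqaff := uq_pi 1.
Definition uq_mul (u v : uqaff) : uqaff := uq_pi (repr u * repr v).

Lemma uq_pi_mul f g : uq_mul (uq_pi f) (uq_pi g) = uq_pi (f * g).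
Proof.
apply/uq_piP.
set f' := repr _; set g' := repr _.
have If : relideal (f' - f) by apply/uq_piP; rewrite /uq_pi reprK.
have Ig : relideal (g' - g) by apply/uq_piP; rewrite /uq_pi reprK.
have -> : f' * g' - f * g = (f' - f) * g' - f * (g - g').
  by rewrite mulrBl mulrBr opprB addrA subrK.
apply: RelIdealB; first exact: RelIdealMr.
apply: RelIdealMl; rewrite -opprB -[X in relideal X]add0r.
by apply: RelIdealB => //; exact: RelIdeal0.
Qed.

Fact uq_mulA : associative uq_mul.
Proof.
move=> u v w; have [f ->] := uq_pi_surj u; have [g ->] := uq_pi_surj v.
by have [h ->] := uq_pi_surj w; rewrite !uq_pi_mul mulrA.
Qed.

Fact uq_mul1 : left_id uq_one uq_mul.
Proof. by move=> u; have [f ->] := uq_pi_surj u; rewrite uq_pi_mul mul1r. Qed.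

Fact uq_1mul : right_id uq_one uq_mul.
Proof. by move=> u; have [f ->] := uq_pi_surj u; rewrite uq_pi_mul mulr1. Qed.

Fact uq_mulDl : left_distributive uq_mul +%R.
Proof.
move=> u v w; have [f ->] := uq_pi_surj u; have [g ->] := uq_pi_surj v.
by have [h ->] := uq_pi_surj w; rewrite -raddfD !uq_pi_mul mulrDl raddfD.
Qed.

Fact uq_mulDr : right_distributive uq_mul +%R.
Proof.
move=> u v w; have [f ->] := uq_pi_surj u; have [g ->] := uq_pi_surj v.
by have [h ->] := uq_pi_surj w; rewrite -raddfD !uq_pi_mul mulrDr raddfD.
Qed.

HB.instance Definition _ := GRing.Zmodule_isPzRing.Build uqaff
  uq_mulA uq_mul1 uq_1mul uq_mulDl uq_mulDr.

Fact uq_pi_monoid_morphism : monoid_morphism uq_pi.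
Proof. by split=> [|f g]; [exact: erefl | exact: esym (uq_pi_mul f g)]. Qed.

HB.instance Definition _ :=
  GRing.isMonoidMorphism.Build F uqaff uq_pi uq_pi_monoid_morphism.

Definition ux b i r : uqaff := uq_pi (fx b i r).
Definition uphi b i r : uqaff := uq_pi (fphi b i r).
Definition uscalar (a : K) : uqaff := uq_pi (a *: 1).

(* The defining generating series identity of the h_(i,m), in degree n > 0. *)
Lemma fh_exp b i n : qpar i != (qpar i)^-1 -> (0 < n)%N ->
  exp_coef (fun m : nat => ((sgn b)%:~R * (qpar i - (qpar i)^-1)) *: fh i (sgn b * m%:Z)) n
  = fpsi b i n.
Proof.
move=> qn n0; rewrite -[RHS](exp_log _ n0) /exp_coef.
have E (m : nat) : ((sgn b)%:~R * (qpar i - (qpar i)^-1)) *: fh i (sgn b * m%:Z)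
           = log_coef (fpsi b i) m.
  case: m => [|m]; first by rewrite mulr0 /fh absz0 {2}/log_coef [nth _ _ _]/= 2!scaler0.
  have -> : fh i (sgn b * m.+1%:Z)
      = ((sgn b)%:~R / (qpar i - (qpar i)^-1)) *: log_coef (fpsi b i) m.+1.
    by rewrite /fh; case: b; rewrite /sgn ?mul1r ?mulN1r ?oppr_gt0 ?abszN.
  rewrite scalerA mulrACA divff ?subr_eq0 // mulr1 -intrM.
  by case: b; rewrite /= ?mulrNN mulr1 scale1r.
by apply: eq_bigr => k _; congr (_ *: _); congr (ser_exp _ k n); apply/funext.
Qed.

End Presentation.

Section SeriesMap.
Variables (K : fieldType) (A B : lalgType K) (h : {lrmorphism A -> B}).

Lemma map_ser_exp (a : nat -> A) k n : h (ser_exp a k n) = ser_exp (h \o a) k n.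
Proof.
elim: k n => [|k IH] n /=; first by rewrite rmorph_nat.
by rewrite /cauchy rmorph_sum; apply: eq_bigr => i _; rewrite rmorphM /= IH.
Qed.

Lemma map_exp_coef (a : nat -> A) n : h (exp_coef a n) = exp_coef (h \o a) n.
Proof.
rewrite /exp_coef linear_sum; apply: eq_bigr => k _.
by rewrite linearZ /= map_ser_exp.
Qed.

Lemma map_log_coef (b : nat -> A) n : h (log_coef b n) = log_coef (h \o b) n.
Proof.
have E m : [seq h x | x <- log_seq b m] = log_seq (h \o b) m.
  elim: m => [|m IH] /=; first by rewrite rmorph0.
  rewrite map_rcons rmorphB /= map_exp_coef IH; congr (rcons _ (_ - exp_coef _ _)).
  apply/funext => k /=; rewrite -IH.
  have [km|km] := ltnP k (size (log_seq b m)); first by rewrite (nth_map 0).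
  by rewrite !nth_default ?size_map // rmorph0.
by rewrite /log_coef -E (nth_map 0) // size_log_seq.
Qed.

End SeriesMap.

Section FreeInclusion.
Variables (K : fieldType) (q : K) (D : cartan_datum) (J : {set D}).
Local Notation DJ := (subdatum J).

Definition gen_incl (g : gen DJ) : gen D :=
  match g with
  | GX b j r => GX b (val j) r
  | GPhi b j r => GPhi b (val j) r
  | GPhiInv b j => GPhiInv b (val j)
  end.

Definition free_incl : {lrmorphism free_alg K (gen DJ) -> free_alg K (gen D)} :=
  free_map (fun g => free_gen K (gen_incl g)).

Variables (nu : coweight DJ) (mu : coweight D).
Hypothesis res_mu : res_coweight J mu = nu.

Lemma res_coweightE (j : DJ) : nu j = mu (val j).
Proof. by rewrite -res_mu ffunE. Qed.

Lemma free_incl_x b (j : DJ) r : free_incl (fx K b j r) = fx K b (val j) r.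
Proof. exact: free_map_gen. Qed.

Lemma free_incl_phi b (j : DJ) r : free_incl (fphi K b j r) = fphi K b (val j) r.
Proof. exact: free_map_gen. Qed.

Lemma free_incl_phiV b (j : DJ) : free_incl (fphiV K b j) = fphiV K b (val j).
Proof. exact: free_map_gen. Qed.

Lemma free_incl0 : free_incl 0 = 0.
Proof. exact: rmorph0. Qed.

Lemma free_incl1 : free_incl 1 = 1.
Proof. exact: rmorph1. Qed.

Lemma free_inclB f g : free_incl (f - g) = free_incl f - free_incl g.
Proof. exact: rmorphB. Qed.

Lemma free_inclM f g : free_incl (f * g) = free_incl f * free_incl g.
Proof. exact: rmorphM. Qed.

Lemma free_inclZ a f : free_incl (a *: f) = a *: free_incl f.
Proof. exact: linearZ. Qed.

Lemma lead_incl b (j : DJ) : lead nu b j = lead mu b (val j).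
Proof. by case: b => //=; rewrite res_coweightE. Qed.

Lemma free_incl_h (j : DJ) m : free_incl (fh q nu j m) = fh q mu (val j) m.
Proof.
rewrite /fh linearZ /= map_log_coef; congr (_ *: log_coef _ _); apply/funext => k /=.
by rewrite /fpsi rmorphM /= free_incl_phi free_incl_phiV lead_incl.
Qed.

Lemma free_incl_serre b (i j : DJ) s p (r : 'I_p -> int) :
  free_incl (serre_lhs q b i j s r) = serre_lhs q b (val i) (val j) s r.
Proof.
rewrite /serre_lhs raddf_sum /=; apply: eq_bigr => t _.
rewrite raddf_sum /=; apply: eq_bigr => l _; rewrite linearZ /= !rmorphM !rmorph_prod /=.
set P1 := \prod_(_ < p | _) _; set P2 := \prod_(_ < p | _) _.
set P3 := \prod_(_ < p | _) _; set P4 := \prod_(_ < p | _) _.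
have -> : P1 = P3 by apply: eq_bigr => k _; exact: free_incl_x.
have -> : P2 = P4 by apply: eq_bigr => k _; exact: free_incl_x.
by rewrite -/(free_incl _) (free_incl_x b j s).
Qed.

Lemma free_incl_rel f g :
  defrel q nu f g -> defrel q mu (free_incl f) (free_incl g).
Proof.
case=> [j r r0|j r r0|b j|b j|b c i j r s|b c i j r|b i j m r m0|i j r s|b i j r s
       |b i j s r ij].
- rewrite free_incl_phi free_incl0; exact: RelSuppP.
- rewrite free_incl_phi free_incl0; apply: RelSuppN; by rewrite -res_coweightE.
- rewrite free_inclM free_incl1 free_incl_phi free_incl_phiV lead_incl.
  exact: RelInvL.
- rewrite free_inclM free_incl1 free_incl_phi free_incl_phiV lead_incl.
  exact: RelInvR.
- rewrite !free_inclM !free_incl_phi; exact: RelPhiPhi.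
- rewrite free_inclZ !free_inclM free_incl_phi free_incl_x lead_incl.
  exact: (@RelPhiX K q D mu b c (val i) (val j) r).
- rewrite free_inclZ /fcomm free_inclB !free_inclM free_incl_h !free_incl_x.
  exact: (@RelHX K q D mu b (val i) (val j) m r).
- rewrite !free_inclZ /fcomm !free_inclB !free_inclM !free_incl_phi !free_incl_x.
  exact: (@RelXX K q D mu (val i) (val j) r s).
- rewrite !free_inclB !free_inclZ !free_inclM !free_incl_x.
  exact: (@RelQuad K q D mu b (val i) (val j) r s).
- rewrite free_incl_serre free_incl0.
  exact: (@RelSerre K q D mu b (val i) (val j) s r).
Qed.

Lemma free_incl_ideal f : relideal q nu f -> relideal q mu (free_incl f).
Proof.
elim=> {f} [f g /free_incl_rel H||f g _ If _ Ig|f g _ Ig|f g _ If].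
- by rewrite free_inclB; exact: RelIdealRel.
- rewrite free_incl0; exact: RelIdeal0.
- rewrite free_inclB; exact: RelIdealB.
- rewrite free_inclM; exact: RelIdealMl.
- rewrite free_inclM; exact: RelIdealMr.
Qed.

End FreeInclusion.

Section Inclusion.
Variables (K : fieldType) (q : K) (D : cartan_datum) (J : {set D}).
Variables (nu : coweight (subdatum J)) (mu : coweight D).
Implicit Type e : res_coweight J mu = nu.

(* The proof [e] is needed only for this to be an algebra morphism. *)
Definition uq_incl e (u : uqaff q nu) : uqaff q mu :=
  uq_pi q mu (free_incl K J (repr u)).

Lemma uq_incl_pi e f : uq_incl e (uq_pi q nu f) = uq_pi q mu (free_incl K J f).
Proof.
apply/uq_piP; rewrite -rmorphB; apply: (free_incl_ideal e).
by apply/uq_piP; rewrite /uq_pi reprK.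
Qed.

Fact uq_incl_additive e : zmod_morphism (uq_incl e).
Proof.
move=> u v; have [f ->] := uq_pi_surj u; have [g ->] := uq_pi_surj v.
by rewrite -raddfB !uq_incl_pi !raddfB.
Qed.

HB.instance Definition _ e :=
  GRing.isZmodMorphism.Build (uqaff q nu) (uqaff q mu) (uq_incl e)
    (uq_incl_additive e).

Fact uq_incl_multiplicative e : monoid_morphism (uq_incl e).
Proof.
split=> [|u v]; first by rewrite -[1]/(uq_pi q nu 1) uq_incl_pi !rmorph1.
have [f ->] := uq_pi_surj u; have [g ->] := uq_pi_surj v.
by rewrite -rmorphM !uq_incl_pi !rmorphM.
Qed.

HB.instance Definition _ e :=
  GRing.isMonoidMorphism.Build (uqaff q nu) (uqaff q mu) (uq_incl e)
    (uq_incl_multiplicative e).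

End Inclusion.

(* V viewed as an R-module through h. *)
Definition restr (R S : pzRingType) (h : {rmorphism R -> S}) (V : lmodType S)
    : Type := V.

Section Restriction.
Variables (R S : pzRingType) (h : {rmorphism R -> S}) (V : lmodType S).
Local Notation restrV := (restr h V).

HB.instance Definition _ := GRing.Zmodule.copy restrV V.

Definition restr_scale (a : R) (v : restrV) : restrV := (h a *: (v : V) : V).

Fact restr_scaleA a b v : restr_scale a (restr_scale b v) = restr_scale (a * b) v.
Proof. by rewrite /restr_scale scalerA rmorphM. Qed.

Fact restr_scale1 : left_id 1 restr_scale.
Proof. by move=> v; rewrite /restr_scale rmorph1 scale1r. Qed.

Fact restr_scaleDr : right_distributive restr_scale +%R.
Proof. by move=> a u v; exact: scalerDr. Qed.

Fact restr_scaleDl v : {morph restr_scale^~ v : a b / a + b}.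
Proof. by move=> a b; rewrite /restr_scale rmorphD; exact: scalerDl. Qed.

HB.instance Definition _ := GRing.Zmodule_isLmodule.Build R restrV
  restr_scaleA restr_scale1 restr_scaleDr restr_scaleDl.

End Restriction.

Section Radical.
Variables (R : pzRingType) (V : lmodType R).

Definition maximal_submod (N : {pred V}) : Prop :=
  [/\ submod_closed N,
      exists v, v \notin N &
      forall N' : {pred V}, submod_closed N' -> {subset N <= N'} ->
        {subset N' <= N} \/ (forall v, v \in N')].

Definition rad_pred : {pred V} :=
  fun v => `[< forall N : {pred V}, maximal_submod N -> v \in N >].

Fact rad_submod_closed : submod_closed rad_pred.
Proof.
split=> [|a u v /asboolP Hu /asboolP Hv]; apply/asboolP => N mN.
  by case: mN => -[].
by case: (mN) => -[_ H] _ _; apply: H; [exact: Hu | exact: Hv].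
Qed.

HB.instance Definition _ :=
  GRing.isSubmodClosed.Build R V rad_pred rad_submod_closed.

Definition mod_rad : Type := {v : V | rad_pred v}.

HB.instance Definition _ := SubChoice.on mod_rad.
HB.instance Definition _ := [SubChoice_isSubLmodule of mod_rad by <:].

Definition rad_closed : zmodClosed V := rad_pred.

Definition mod_top : Type := Quotient.quot rad_closed.

HB.instance Definition _ := GRing.Zmodule.on mod_top.

Definition top_pi : V -> mod_top := \pi_(Quotient.quot rad_closed)%qT.

Lemma top_piP u v : top_pi u = top_pi v <-> u - v \in rad_pred.
Proof.
rewrite /top_pi; split=> [/eqP|H]; last apply/eqP; by rewrite -Quotient.idealrBE.
Qed.

Lemma top_pi_surj (x : mod_top) : exists v, x = top_pi v.
Proof. by exists (repr x); rewrite /top_pi reprK. Qed.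

Fact top_pi_additive : zmod_morphism top_pi.
Proof. by move=> u v; rewrite /top_pi raddfB. Qed.

HB.instance Definition _ :=
  GRing.isZmodMorphism.Build V mod_top top_pi top_pi_additive.

Definition top_scale (a : R) (x : mod_top) : mod_top := top_pi (a *: repr x).

Lemma top_pi_scale a v : top_scale a (top_pi v) = top_pi (a *: v).
Proof.
apply/top_piP; rewrite -scalerBr rpredZ //.
by apply/top_piP; rewrite /top_pi reprK.
Qed.

Fact top_scaleA a b x : top_scale a (top_scale b x) = top_scale (a * b) x.
Proof. by have [v ->] := top_pi_surj x; rewrite !top_pi_scale scalerA. Qed.

Fact top_scale1 : left_id 1 top_scale.
Proof. by move=> x; have [v ->] := top_pi_surj x; rewrite top_pi_scale scale1r. Qed.

Fact top_scaleDr : right_distributive top_scale +%R.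
Proof.
move=> a x y; have [u ->] := top_pi_surj x; have [v ->] := top_pi_surj y.
by rewrite -raddfD !top_pi_scale -raddfD scalerDr.
Qed.

Fact top_scaleDl x : {morph top_scale^~ x : a b / a + b}.
Proof.
by move=> a b; have [v ->] := top_pi_surj x; rewrite !top_pi_scale scalerDl raddfD.
Qed.

HB.instance Definition _ := GRing.Zmodule_isLmodule.Build R mod_top
  top_scaleA top_scale1 top_scaleDr top_scaleDl.

Fact top_pi_scalable : scalable top_pi.
Proof. by move=> a v; rewrite -top_pi_scale. Qed.

HB.instance Definition _ := GRing.isScalable.Build R V mod_top *:%R top_pi
  top_pi_scalable.

End Radical.

Definition coef_int (K : fieldType) (p : {poly K}) (r : int) : K :=
  if r is Posz n then p`_n else 0.

(* The series \sum_r (c r) z^r solves q(z) c(z) = p(z), where f = p / q. *)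
Definition series_of (K : fieldType) (f : {fraction {poly K}}) (c : int -> K) : Prop :=
  exists p q : {poly K}, [/\ q != 0, f = tofrac p / tofrac q &
    forall r : int, \sum_(k < size q) q`_k * c (r - k%:Z) = coef_int p r].

(* Laurent expansion at 0 (for +), resp. at infinity (for -). *)
Definition laurent_expansion (K : fieldType) (b : bool) (f : {fraction {poly K}})
    (c : int -> K) : Prop :=
  series_of f c /\ exists N : int, forall r : int, sgn b * r < N -> c r = 0.

Definition regular_nonzero_at0 (K : fieldType) (f : {fraction {poly K}}) : Prop :=
  exists p q : {poly K}, [/\ p.[0] != 0, q.[0] != 0 & f = tofrac p / tofrac q].

Section CategoryO.
Variables (K : fieldType) (q : K) (D : cartan_datum) (nu : coweight D).
Variable V : lmodType (uqaff q nu).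
Implicit Types (v w : V) (b : bool) (i j : D) (r : int).

Definition torus := {g : {ffun D -> K} | [forall i, g i != 0]}.

Implicit Types g : torus.

Definition torus_le g g' : Prop :=
  exists a : D -> nat, forall j : D,
    val g' j / val g j = \prod_i qpar q j ^ ((a i)%:Z * dmat j i).

(* V_gamma^+ for [true], V_gamma^- for [false]. *)
Definition weight_vec b g v : Prop :=
  forall i, uphi q nu b i (lead nu b i) *: v = uscalar q nu (val g i ^ sgn b) *: v.

Definition is_weight b g : Prop := exists2 v, v != 0 & weight_vec b g v.

Definition weight_direct b : Prop :=
  (forall v, exists (s : seq torus) (w : torus -> V),
      (forall g, weight_vec b g (w g)) /\ v = \sum_(g <- s) w g) /\
  (forall (s : seq torus) (w : torus -> V),
      uniq s -> (forall g, weight_vec b g (w g)) -> \sum_(g <- s) w g = 0 ->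
      forall g, g \in s -> w g = 0).

Definition weight_findim b g : Prop :=
  exists n (e : 'I_n -> V), (forall k, weight_vec b g (e k)) /\
    forall v, weight_vec b g v ->
      exists c : 'I_n -> K, v = \sum_k uscalar q nu (c k) *: e k.

Definition category_O : Prop :=
  [/\ forall b, weight_direct b,
      forall b g, weight_findim b g &
      exists s : seq torus, forall b g, is_weight b g ->
        exists2 g', g' \in s & torus_le g g'].

Definition highest_lweight : Prop :=
  category_O /\
  exists (Psi : D -> {fraction {poly K}}) (v : V),
    [/\ v != 0,
        forall w, exists u : uqaff q nu, w = u *: v,
        forall j r, ux q nu true j r *: v = 0,
        forall j, regular_nonzero_at0 (Psi j) &
        forall b j, exists2 c : int -> K, laurent_expansion b (Psi j) c &
          forall r, uphi q nu b j r *: v = uscalar q nu (c r) *: v].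

End CategoryO.

Definition is_inflation (K : fieldType) (q : K) (D : cartan_datum) (J : {set D})
    (nu : coweight (subdatum J)) (mu : coweight D)
    (res_mu : res_coweight J mu = nu)
    (W : lmodType (uqaff q nu)) (V : lmodType (uqaff q mu)) : Prop :=
  [/\ category_O W, category_O V,
      exists f : {linear restr (uq_incl (q := q) res_mu) V -> W}, bijective f &
      forall (i : D) (b : bool) (r : int) (v : V),
        i \notin J -> ux q mu b i r *: v = 0].

(* Main.v *)
(* Let v be the highest l-weight vector of W, S the sum of the images of the
   x^-_(j,r), and M the largest submodule of W contained in S. Straightening
   gives W = K v + S, where S is a sum of weight spaces whose weights differ
   from that of v, because the Cartan form is positive definite and q is not a
   root of unity. As submodules are sums of weight spaces, every proper
   submodule lies in M, so M = rad W. Transport M to V. The elements h_(i,m)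
   and the invertible leading coefficients of phi^+-_i(z), for all i in I,
   preserve S, and they normalise U^nu_q(g_J), since they commute with each x
   up to a scalar and a multiple of a shifted x. Hence they preserve M, and
   M is a U^mu_q(g)-submodule of V, which contains every proper submodule
   of V; thus rad V = M as well. *)
From HB Require Import structures.
Require Import Defs.
From mathcomp Require Import all_boot all_order all_algebra.
From mathcomp Require Import boolp reals complex.

Set Implicit Arguments.
Unset Strict Implicit.
Unset Printing Implicit Defensive.

Import Order.TTheory GRing.Theory Num.Theory.
Local Open Scope ring_scope.

(** * Closure of subalgebras under exponential and logarithm coefficients *)

Section LogClosed.
Variables (K : fieldType) (A : lalgType K) (P : A -> Prop).
Hypotheses (P1 : P 1) (PZ : forall a f, P f -> P (a *: f))
  (PD : forall f g, P f -> P g -> P (f + g))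
  (PM : forall f g, P f -> P g -> P (f * g)).

Let P0 : P 0. Proof. by rewrite -(scale0r (1 : A)); exact: PZ. Qed.

(** Each coefficient is a polynomial in the given sequence. With [log_coef_closed] this passes
    closure properties between the phi^+-_(i,r) and the h_(i,m). *)
Lemma exp_coef_closed (a : nat -> A) n :
  (forall k, P (a k)) -> P (exp_coef a n).
Proof.
move=> Pa; rewrite /exp_coef; elim/big_ind: _ => // k _; apply: PZ.
move: (k : nat) => e {k}; elim: e n => [|e IH] n /=; first by case: (n == 0%N).
by rewrite /cauchy; elim/big_ind: _ => // i _; exact: PM.
Qed.

Lemma log_coef_closed (b : nat -> A) n :
  (forall k, P (b k)) -> P (log_coef b n).
Proof.
(* The position is generalised apart from the length; past the end [nth] returns 0, which satisfies
   [P]. *)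
move=> Pb; rewrite /log_coef; elim: n {2}n => [|n IH] k /=.
  by case: k => [|k] //=; rewrite nth_nil.
rewrite nth_rcons size_log_seq; case: ifP => // _; case: ifP => // _.
apply: PD => //; rewrite -scaleN1r; apply: PZ; exact: exp_coef_closed.
Qed.

End LogClosed.

(** * Shifted quantum affine algebras *)

Section Uq.
Variables (K : fieldType) (q : K) (D : cartan_datum) (nu : coweight D).
Local Notation U := (uqaff q nu).
Local Notation pi := (uq_pi q nu).
Local Notation "a %:U" := (uscalar q nu a) (at level 2, format "a %:U").
Implicit Types (a c : K) (u v y : U) (b : bool) (i j : D) (r s m : int).

Definition uphiV b i : U := pi (fphiV K b i).
Definition uh i m : U := pi (fh q nu i m).
Definition uphi0 b i : U := uphi q nu b i (lead nu b i).

Lemma uq_rel f g : defrel q nu f g -> pi f = pi g.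
Proof. by move=> H; apply/uq_piP; exact: RelIdealRel. Qed.

Lemma uq_piZ a f : pi (a *: f) = a%:U * pi f.
Proof. by rewrite /uscalar -rmorphM /= -scalerAl mul1r. Qed.

Lemma uscalarC a u : a%:U * u = u * a%:U.
Proof.
have [f ->] := uq_pi_surj u.
by rewrite -uq_piZ /uscalar -rmorphM /= -scalerAr mulr1.
Qed.

Lemma uscalarM a c : (a * c)%:U = a%:U * c%:U.
Proof. by rewrite -[c%:U]/(pi (c *: 1)) -uq_piZ scalerA. Qed.

Lemma uscalarD a c : (a + c)%:U = a%:U + c%:U.
Proof. by rewrite /uscalar scalerDl raddfD. Qed.

Lemma uscalarN a : (- a)%:U = - a%:U.
Proof. by rewrite /uscalar scaleNr raddfN. Qed.

Lemma uscalar0 : 0%:U = 0.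
Proof. by rewrite /uscalar scale0r raddf0. Qed.

Lemma uscalar1 : 1%:U = 1.
Proof. by rewrite /uscalar scale1r rmorph1. Qed.

Lemma uscalarVK c : c != 0 -> c^-1%:U * c%:U = 1.
Proof. by move=> c0; rewrite -uscalarM mulVf // uscalar1. Qed.

(** Containing the scalars replaces closure under 0, 1, opposites and scaling, since [K] acts
    through [uscalar]. *)
Definition uq_subalg (Q : U -> Prop) : Prop :=
  [/\ forall a, Q a%:U, forall u v, Q u -> Q v -> Q (u + v) &
      forall u v, Q u -> Q v -> Q (u * v)].

Lemma uq_ind (Q : U -> Prop) : uq_subalg Q ->
  (forall b i r, Q (ux q nu b i r)) -> (forall b i r, Q (uphi q nu b i r)) ->
  (forall b i, Q (uphiV b i)) -> forall u, Q u.
Proof.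
move=> [Qs QD QM] Qx Qphi QphiV u; have [f ->] := uq_pi_surj u.
elim/free_ind: f => [|[b i r|b i r|b i]|a f Qf|f g Qf Qg|f g Qf Qg].
- by rewrite rmorph1 -uscalar1.
- exact: Qx.
- exact: Qphi.
- exact: QphiV.
- by rewrite uq_piZ; exact: QM.
- by rewrite raddfD; exact: QD.
- by rewrite rmorphM; exact: QM.
Qed.

Lemma uphiVK b i : uphiV b i * uphi0 b i = 1.
Proof. by rewrite -(rmorph1 (pi)) -rmorphM; exact: uq_rel (RelInvL _ _ _ _). Qed.

Lemma uphiKV b i : uphi0 b i * uphiV b i = 1.
Proof. by rewrite -(rmorph1 (pi)) -rmorphM; exact: uq_rel (RelInvR _ _ _ _). Qed.

Lemma uphiC b b' i j r s :
  uphi q nu b i r * uphi q nu b' j s = uphi q nu b' j s * uphi q nu b i r.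
Proof. by rewrite -!rmorphM; exact: uq_rel (RelPhiPhi _ _ _ _ _ _ _ _). Qed.

Lemma uphiV_comm b i u : uphi0 b i * u = u * uphi0 b i -> uphiV b i * u = u * uphiV b i.
Proof.
move=> H; rewrite -[LHS]mulr1 -(uphiKV b i) mulrA -[_ * u * _]mulrA -H.
by rewrite mulrA uphiVK mul1r.
Qed.

Lemma uh_closed (Q : U -> Prop) i m : uq_subalg Q ->
  (forall b r, Q (uphi q nu b i r)) -> (forall b, Q (uphiV b i)) -> Q (uh i m).
Proof.
move=> [Qs QD QM] Qphi QphiV; rewrite /uh /fh uq_piZ; apply: (QM) => //.
apply: (log_coef_closed (P := fun f => Q (pi f))) => [|a f Qf|f g Qf Qg|f g Qf Qg|k].
- by rewrite rmorph1 -uscalar1.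
- by rewrite uq_piZ; exact: QM.
- by rewrite raddfD; exact: QD.
- by rewrite rmorphM; exact: QM.
- by rewrite /fpsi rmorphM; apply: (QM); [exact: QphiV | exact: Qphi].
Qed.

(* By [fh_exp], these elements generate all the phi^+-_(i,r); unlike the
   latter, each of them moves past x^+-_(j,r) in a single step, see
   [cartan_gen_x]. *)
Inductive cartan_gen : U -> Prop :=
| CartanPhi b i : cartan_gen (uphi0 b i)
| CartanPhiV b i : cartan_gen (uphiV b i)
| CartanH i m : m != 0 -> cartan_gen (uh i m).

Hypothesis qiV : forall i, qpar q i != (qpar q i)^-1.

(** By [fh_exp], a coefficient inside the support is the leading one times an exponential
    coefficient in the h_(i,m); outside the support it is the scalar 0. *)
Lemma uphi_closed (Q : U -> Prop) b i r : uq_subalg Q ->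
  (forall y, cartan_gen y -> Q y) -> Q (uphi q nu b i r).
Proof.
move=> [Qs QD QM] Qy.
have Q0 : Q 0 by rewrite -uscalar0.
have key n : Q (uphi q nu b i (lead nu b i + sgn b * n%:Z)).
  case: n => [|n]; first by rewrite mulr0 addr0; apply: Qy; exact: CartanPhi.
  rewrite -[uphi _ _ _ _ _]mul1r -(uphiKV b i) -mulrA; apply: (QM).
    by apply: Qy; exact: CartanPhi.
  rewrite -rmorphM -/(fpsi K nu b i n.+1) -(@fh_exp _ q) //.
  apply: (exp_coef_closed (P := fun f => Q (pi f))) => [|a f Qf|f g Qf Qg|f g Qf Qg|k].
  - by rewrite rmorph1 -uscalar1.
  - by rewrite uq_piZ; exact: QM.
  - by rewrite raddfD; exact: QD.
  - by rewrite rmorphM; exact: QM.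
  - rewrite uq_piZ; apply: (QM) => //; case: k => [|k].
      (* [CartanH] covers nonzero indices only; at index 0, [fh] is the constant term of a
         logarithm, hence zero. *)
      by rewrite mulr0 /fh log_coef0 scaler0 raddf0.
    by apply: Qy; apply: CartanH; case: b.
case: b key => /= key.
  case: r => n; first by have := key n; rewrite add0r mul1r.
  by rewrite (_ : uphi _ _ _ _ _ = 0) // -(raddf0 (pi)); apply: uq_rel; exact: RelSuppP.
have [r_nu|r_nu] := leP r (nu i).
  by have := key `|nu i - r|%N; rewrite gez0_abs ?subr_ge0 // mulN1r opprB addrC subrK.
by rewrite (_ : uphi _ _ _ _ _ = 0) // -(raddf0 (pi)); apply: uq_rel; exact: RelSuppN.
Qed.

Lemma uq_cartan_ind (Q : U -> Prop) : uq_subalg Q ->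
  (forall b i r, Q (ux q nu b i r)) -> (forall y, cartan_gen y -> Q y) ->
  forall u, Q u.
Proof.
move=> HQ Qx Qy; apply: uq_ind => // [b i r|b i].
  exact: uphi_closed.
by apply: Qy; exact: CartanPhiV.
Qed.

(** The commutant of phi^+-_(j,r) is a subalgebra closed under inverses, so it contains the h_(i,m)
    along with all the phi. *)
Lemma cartan_gen_comm y b j r : cartan_gen y ->
  uphi q nu b j r * y = y * uphi q nu b j r.
Proof.
have HV (c : bool) i : uphi q nu b j r * uphiV c i = uphiV c i * uphi q nu b j r.
  by apply: esym; apply: uphiV_comm; exact: uphiC.
case=> [c i|c i|i m _]; [exact: uphiC | exact: HV |].
apply: (uh_closed (Q := fun u => uphi q nu b j r * u = u * uphi q nu b j r)) => //.
  split=> [a|u v Hu Hv|u v Hu Hv]; first by rewrite uscalarC.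
    by rewrite mulrDl mulrDr Hu Hv.
  by rewrite mulrA Hu -mulrA Hv mulrA.
by move=> c s; exact: uphiC.
Qed.

Hypothesis q0 : q != 0.

Lemma qpar_neq0 i : qpar q i != 0.
Proof. by rewrite expf_neq0. Qed.

Lemma uphi0_x b b' i j r : uphi0 b i * ux q nu b' j r =
  (qpar q i ^ (sgn b * sgn b' * dmat i j))%:U * (ux q nu b' j r * uphi0 b i).
Proof. rewrite -[LHS]rmorphM -[X in _ = _ * X]rmorphM -uq_piZ.
by apply: uq_rel; exact: RelPhiX. Qed.

Lemma uh_x b i j m r : m != 0 -> uh i m * ux q nu b j r =
  ux q nu b j r * uh i m +
  ((sgn b)%:~R / m%:~R * quantum_int (qpar q i) (m * dmat i j))%:U * ux q nu b j (m + r).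
Proof.
move=> m0; apply/eqP; rewrite addrC -subr_eq; apply/eqP.
rewrite -[X in X - _]rmorphM -[X in _ - X]rmorphM -raddfB -uq_piZ.
by apply: uq_rel; exact: RelHX.
Qed.

Lemma cartan_gen_x y b j r : cartan_gen y -> exists c d s,
  y * ux q nu b j r = c%:U * (ux q nu b j r * y) + d%:U * ux q nu b j s.
Proof.
case=> [c i|c i|i m m0].
- exists (qpar q i ^ (sgn c * sgn b * dmat i j)), 0, r.
  by rewrite uscalar0 mul0r addr0 uphi0_x.
- exists (qpar q i ^ (sgn c * sgn b * dmat i j))^-1, 0, r.
  rewrite uscalar0 mul0r addr0; set a := _ ^ _.
  have a0 : a != 0 by rewrite expfz_neq0 // qpar_neq0.
  have xP : ux q nu b j r * uphi0 c i = a^-1%:U * (uphi0 c i * ux q nu b j r).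
    by rewrite uphi0_x mulrA uscalarVK ?mul1r.
  rewrite -[LHS]mulr1 -(uphiKV c i) mulrA -[_ * _ * uphi0 c i]mulrA xP !mulrA.
  by rewrite -[uphiV c i * _]uscalarC -[_ * uphiV c i * _]mulrA uphiVK mulr1.
- exists 1, ((sgn b)%:~R / m%:~R * quantum_int (qpar q i) (m * dmat i j)), (m + r).
  by rewrite uscalar1 mul1r uh_x.
Qed.

(** The relations behind [cartan_gen_x], solved for the product with x on the left, which is the
    order that [cartan_gen_normal] needs. *)
Lemma x_cartan_gen y b j r : cartan_gen y -> exists c d s,
  ux q nu b j r * y = c%:U * (y * ux q nu b j r) + d%:U * ux q nu b j s.
Proof.
case=> [c i|c i|i m m0].
- exists (qpar q i ^ (sgn c * sgn b * dmat i j))^-1, 0, r.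
  by rewrite uscalar0 mul0r addr0 uphi0_x mulrA uscalarVK ?mul1r // expfz_neq0 // qpar_neq0.
- exists (qpar q i ^ (sgn c * sgn b * dmat i j)), 0, r.
  rewrite uscalar0 mul0r addr0; set a := _ ^ _.
  rewrite -[LHS]mul1r -(uphiVK c i) -!mulrA [uphi0 c i * _]mulrA uphi0_x -/a.
  by rewrite -!mulrA uphiKV mulr1 mulrA -uscalarC -mulrA.
- exists 1, (- ((sgn b)%:~R / m%:~R * quantum_int (qpar q i) (m * dmat i j))), (m + r).
  by rewrite uscalar1 mul1r uh_x // uscalarN mulNr addrK.
Qed.

Lemma ux_comm i j r s :
  ux q nu true i r * ux q nu false j s =
  ux q nu false j s * ux q nu true i r +
  ((i == j)%:R / (qpar q i - (qpar q i)^-1))%:U *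
    (uphi q nu true i (r + s) - uphi q nu false j (r + s)).
Proof.
set a := qpar q i - _; have a0 : a != 0 by rewrite subr_eq0.
have H : a%:U * (ux q nu true i r * ux q nu false j s - ux q nu false j s * ux q nu true i r) =
    (i == j)%:R%:U * (uphi q nu true i (r + s) - uphi q nu false j (r + s)).
  have := uq_rel (RelXX q nu i j r s).
  by rewrite !uq_piZ /fcomm !raddfB /= !rmorphM.
apply/eqP; rewrite addrC -subr_eq; apply/eqP.
by rewrite [_ / _]mulrC uscalarM -mulrA -H mulrA uscalarVK ?mul1r.
Qed.

End Uq.

(** * Submodules and weight spaces *)

Section Submodules.
Variables (R : pzRingType) (V : lmodType R) (N : {pred V}).
Hypothesis HN : submod_closed N.

Lemma submodD u v : u \in N -> v \in N -> u + v \in N.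
Proof. by move=> Hu Hv; rewrite -[u]scale1r; exact: HN.2. Qed.

Lemma submodZ a v : v \in N -> a *: v \in N.
Proof. by move=> Hv; rewrite -[_ *: _]addr0; apply: HN.2 => //; exact: HN.1. Qed.

Lemma submodB u v : u \in N -> v \in N -> u - v \in N.
Proof. by move=> Hu Hv; rewrite -scaleN1r; apply: submodD => //; exact: submodZ. Qed.

(** Under these hypotheses [N] is the unique maximal submodule, so the intersection defining the
    radical has [N] as its only member. *)
Lemma rad_predE : (exists v, v \notin N) ->
  (forall N' : {pred V}, submod_closed N' -> (exists v, v \notin N') -> {subset N' <= N}) ->
  rad_pred (V := V) =i N.
Proof.
move=> pN maxN v; apply/idP/idP => [/asboolP radv|vN].
  apply: radv; split=> // N' N'sub NN'.
  have [pN'|npN'] := pselect (exists v, v \notin N'); first by left; exact: maxN.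
  by right=> u; apply/negPn/negP => uN'; apply: npN'; exists u.
apply/asboolP => N' [N'sub pN' maxN'].
have [/(_ v vN) //|all_N] := maxN' N HN (maxN N' N'sub pN').
by have [u] := pN; rewrite all_N.
Qed.

End Submodules.

Lemma image_submod_closed (R : pzRingType) (V' V : lmodType R) (f : {linear V' -> V}) :
  submod_closed (fun v : V => `[< exists x, v = f x >]).
Proof.
split=> [|a u v /asboolP[x ->] /asboolP[y ->]]; apply/asboolP.
  by exists 0; rewrite linear0.
by exists (a *: x + y); rewrite linearP.
Qed.

(** Take vectors of [P] spanning a space of maximal rank: adjoining another element of [P] cannot
    raise the rank. This gives finite spanning families for weight spaces of submodules. *)
Lemma subspace_fingen (K : fieldType) n (P : 'rV[K]_n -> Prop) :
  exists m (A : 'M[K]_(m, n)), (forall k, P (row k A)) /\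
    forall c, P c -> (c <= A)%MS.
Proof.
pose Q r := `[< exists m (A : 'M[K]_(m, n)), (forall k, P (row k A)) /\ \rank A = r >].
have Q0 : exists r, Q r.
  by exists 0%N; apply/asboolP; exists 0%N, 0; split=> [[]//|]; rewrite mxrank0.
have Qn r : Q r -> (r <= n)%N.
  by move=> /asboolP[m [A [_ <-]]]; exact: rank_leq_col.
have [r /asboolP[m [A [PA rA]]] maxr] := ex_maxnP Q0 Qn.
exists m, A; split=> // c Pc.
have Qc : Q (\rank (col_mx A c)).
  apply/asboolP; exists (m + 1)%N, (col_mx A c); split=> // k.
  have [j ->|j ->] := split_ordP k; first by rewrite rowKu.
  by rewrite rowKd row_id.
have := maxr _ Qc; rewrite -rA => rle.
have : (A == col_mx A c)%MS.
  by rewrite -mxrank_leqif_eq ?eqn_leq ?rle ?andbT ?mxrankS // -addsmxE addsmxSl.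
by case/andP => _; rewrite col_mx_sub => /andP[].
Qed.

Section Weights.
Variables (K : fieldType) (q : K) (D : cartan_datum) (nu : coweight D).
Local Notation U := (uqaff q nu).
Local Notation "a %:U" := (uscalar q nu a) (at level 2, format "a %:U").

Definition eigen (V : lmodType U) (I : Type) (t : I -> U) (g : I -> K) (v : V) : Prop :=
  forall i, t i *: v = (g i)%:U *: v.

Lemma eigenZ (V : lmodType U) I (t : I -> U) g c (v : V) :
  eigen t g v -> eigen t g (c%:U *: v).
Proof. by move=> Hv i; rewrite scalerA -uscalarC -scalerA Hv !scalerA uscalarC. Qed.

Lemma scaler_uscalar_mem (V : lmodType U) (N : {pred V}) c v : submod_closed N ->
  c != 0 -> c%:U *: v \in N -> v \in N.
Proof.
move=> HN c0 cv; rewrite -[v]scale1r -(uscalarVK q nu c0) -scalerA.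
exact: submodZ.
Qed.

(* Applying [t i - g k i], where [g k i != g0 i], removes one summand at a time. *)
Lemma eigen_component (V : lmodType U) (N : {pred V}) I (t : I -> U) (T : eqType)
    (r : seq T) (g0 : I -> K) (w0 : V) (g : T -> I -> K) (w : T -> V) :
  submod_closed N -> eigen t g0 w0 -> {in r, forall k, eigen t (g k) (w k)} ->
  {in r, forall k, exists i, g k i != g0 i} ->
  w0 + \sum_(k <- r) w k \in N -> w0 \in N.
Proof.
move=> HN; elim: r w0 w => [|a r IH] w0 w ew0 ew gg0; first by rewrite big_nil addr0.
rewrite big_cons => sumN.
have [i gai] := gg0 a (mem_head _ _).
have c0 : g0 i - g a i != 0 by rewrite subr_eq0 eq_sym.
apply: (scaler_uscalar_mem HN c0).
apply: (IH _ (fun k => (g k i - g a i)%:U *: w k)).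
- exact: eigenZ.
- by move=> k kr; apply: eigenZ; apply: ew; rewrite inE kr orbT.
- by move=> k kr; apply: gg0; rewrite inE kr orbT.
have := submodB HN (submodZ HN (t i) sumN) (submodZ HN (g a i)%:U sumN).
rewrite !scalerDr ew0 ew ?mem_head // opprD addrACA opprD [X in _ + X]addrACA subrr add0r.
rewrite -scalerBl -uscalarN -uscalarD !scaler_sumr -sumrB.
rewrite (eq_big_seq (fun k => (g k i - g a i)%:U *: w k)) // => k kr.
by rewrite ew ?inE ?kr ?orbT // -scalerBl -uscalarN -uscalarD.
Qed.

End Weights.

Lemma zero_submod_closed (R : pzRingType) (V : lmodType R) :
  submod_closed (fun v : V => v == 0).
Proof.
split=> [|a u v /eqP -> /eqP ->]; first exact: eqxx.
by rewrite scaler0 addr0; exact: eqxx.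
Qed.

(** * Stability of category O under submodules and quotients *)

Section CategoryO.
Variables (K : fieldType) (q : K) (D : cartan_datum) (nu : coweight D).
Local Notation U := (uqaff q nu).
Local Notation "a %:U" := (uscalar q nu a) (at level 2, format "a %:U").
Implicit Types (b : bool) (g h : torus K D).

Lemma torus_neq b g h : g != h -> exists i, val g i ^ sgn b != val h i ^ sgn b.
Proof.
move=> gh; apply: contrapT => H; case/eqP: gh; apply/val_inj/ffunP => i.
have : val g i ^ sgn b = val h i ^ sgn b.
  by apply/eqP/negPn/negP => gi; apply: H; exists i.
by case: b {H} => //; exact: invr_inj.
Qed.

Lemma weight_vecMn (V : lmodType U) b g (v : V) n : weight_vec b g v -> weight_vec b g (v *+ n).
Proof. by move=> Hv i; rewrite -!scalerMnr Hv. Qed.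

Lemma weight_vec_lin (V V' : lmodType U) (f : {linear V' -> V}) b g (x : V') :
  weight_vec b g x -> weight_vec b g (f x).
Proof. by move=> Hx i; have := congr1 f (Hx i); rewrite !linearZ. Qed.

Lemma weight_vec_inj (V V' : lmodType U) (f : {linear V' -> V}) b g (x : V') :
  injective f -> weight_vec b g (f x) -> weight_vec b g x.
Proof. by move=> finj Hx i; apply: finj; rewrite !linearZ; exact: Hx. Qed.

Lemma weight_component (V : lmodType U) (N : {pred V}) b (s : seq (torus K D))
    (w : torus K D -> V) g :
  submod_closed N -> uniq s -> (forall h, weight_vec b h (w h)) ->
  \sum_(h <- s) w h \in N -> g \in s -> w g \in N.
Proof.
move=> HN us Hw sN gs; rewrite (big_rem g) //= in sN.
apply: (eigen_component (t := uphi0 q nu b) (g0 := fun i => val g i ^ sgn b)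
  (g := fun h i => val h i ^ sgn b) HN _ _ _ sN) => [|h _|h]; try exact: Hw.
by rewrite mem_rem_uniq // inE => /andP[hg _]; exact: torus_neq.
Qed.

(** The weights listed in [weight_direct] may repeat; scaling each component by its multiplicity
    makes them distinct and also kills the components off the list. *)
Lemma weight_sum_uniq (V : lmodType U) b (v : V) : weight_direct V b ->
  exists s (w : torus K D -> V), [/\ uniq s, forall g, weight_vec b g (w g),
    v = \sum_(g <- s) w g & forall g, g \notin s -> w g = 0].
Proof.
case=> [/(_ v)[s [w [Hw ->]]] _]; exists (undup s), (fun g => w g *+ count_mem g s).
split=> [|g||g]; first exact: undup_uniq.
- exact: weight_vecMn.
- by rewrite -big_undup_iterop_count.
- by rewrite mem_undup => /count_memPn ->.
Qed.

(** Independence is automatic, by [weight_component] for the zero submodule. Hence only the spanning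
    half of [weight_direct] needs proof for submodules and quotients. *)
Lemma weight_direct_uniq (V : lmodType U) b (s : seq (torus K D)) (w : torus K D -> V) :
  uniq s -> (forall g, weight_vec b g (w g)) -> \sum_(g <- s) w g = 0 ->
  forall g, g \in s -> w g = 0.
Proof.
move=> us Hw s0 g gs; apply/eqP.
apply: (weight_component (N := fun v => v == 0) (zero_submod_closed V) us Hw _ gs).
by rewrite s0; exact: eqxx.
Qed.

Lemma category_O_sub (V V' : lmodType U) (f : {linear V' -> V}) :
  injective f -> category_O V -> category_O V'.
Proof.
move=> finj [Vdir Vfin [S HS]]; split=> [b|b g|].
- split=> [x|]; last exact: weight_direct_uniq.
  have [s [w [us Hw fx w0]]] := weight_sum_uniq (f x) (Vdir b).
  (* The image of [f] is a submodule, so it contains the weight components of [f x]. *)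
  have Hw' g : exists x, w g = f x.
    have [gs|/w0 ->] := boolP (g \in s); last by exists 0; rewrite linear0.
    apply/asboolP; apply: (weight_component (image_submod_closed f) us Hw _ gs).
    by apply/asboolP; exists x.
  have [w' w'E] := choice Hw'.
  exists s, w'; split=> [g|]; first by apply: (weight_vec_inj finj); rewrite -w'E.
  by apply: finj; rewrite linear_sum fx; apply: eq_bigr => g _.
- have [n [e [_ He]]] := Vfin b g.
  pose lc (c : 'rV[K]_n) := \sum_k (c 0 k)%:U *: e k.
  have lcD m (c : 'rV[K]_m) (A : 'M[K]_(m, n)) :
      lc (c *m A) = \sum_k (c 0 k)%:U *: lc (row k A).
    rewrite /lc; under [RHS]eq_bigr do rewrite scaler_sumr.
    rewrite exchange_big; apply: eq_bigr => j _ /=; rewrite mxE.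
    elim/big_rec2: _ => [|k u a _ IH]; first by rewrite uscalar0 scale0r.
    by rewrite mxE uscalarD uscalarM scalerDl scalerA IH.
  (* Coordinate vectors, with respect to [e], of the weight vectors coming from [V']. *)
  pose P c := exists x, weight_vec b g x /\ f x = lc c.
  have [m [A [/choice[x Hx] PA]]] := subspace_fingen P.
  exists m, x; split=> [k|y Hy]; first by have [] := Hx k.
  have [c fy] := He _ (weight_vec_lin f Hy).
  have /PA/submxP[d cA] : P (\row_k c k).
    by exists y; split=> //; rewrite fy; apply: eq_bigr => k _; rewrite mxE.
  exists (d 0); apply: finj; rewrite fy linear_sum.
  have -> : \sum_k (c k)%:U *: e k = lc (\row_k c k).
    by apply: eq_bigr => k _; rewrite mxE.
  by rewrite cA lcD; apply: eq_bigr => k _; rewrite linearZ /= (Hx k).2.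
- exists S => b g [x x0 Hx]; apply: (HS b); exists (f x); last exact: weight_vec_lin.
  by rewrite -(linear0 f) (inj_eq finj).
Qed.

Lemma category_O_quo (V V' : lmodType U) (f : {linear V -> V'}) :
  (forall y, exists x, y = f x) -> category_O V -> category_O V'.
Proof.
move=> fsurj [Vdir Vfin [S HS]].
(* Weight vectors lift: among the weight components of a preimage, only the one of weight [g] can
   contribute to [y]. *)
have lift b g y : weight_vec b g y -> exists2 x, weight_vec b g x & y = f x.
  move=> Hy; have [x yE] := fsurj y.
  have [s [w [us Hw xE w0]]] := weight_sum_uniq x (Vdir b).
  (* [r] lists the other weights; if [g] does not occur in [s], then [w g] is 0 and the same formula
     holds. *)
  have [r gr xr] : exists2 r, g \notin r & x = w g + \sum_(h <- r) w h.
    have [gs|gs] := boolP (g \in s); last by exists s; rewrite // w0 // add0r.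
    by exists (rem g s); [rewrite mem_rem_uniq // inE eqxx | rewrite xE (big_rem g)].
  exists (w g) => //; apply/eqP; rewrite -subr_eq0.
  apply: (eigen_component (N := fun v => v == 0) (t := uphi0 q nu b) (r := r)
    (g0 := fun i => val g i ^ sgn b) (g := fun h i => val h i ^ sgn b)
    (w := fun h => - f (w h)) (zero_submod_closed V')).
  - by move=> i; rewrite !scalerBr Hy (weight_vec_lin f (Hw g)).
  - by move=> h _ i; rewrite !scalerN (weight_vec_lin f (Hw h)).
  - by move=> h hr; apply: torus_neq; apply: contraNneq gr => <-.
  apply/eqP; rewrite yE xr linearD linear_sum [f (w g) + _]addrC addrK sumrN subrr.
  by [].
split=> [b|b g|].
- split=> [y|]; last exact: weight_direct_uniq.
  have [x ->] := fsurj y; have [s [w [Hw ->]]] := (Vdir b).1 x.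
  exists s, (f \o w); split=> [g|]; first exact: weight_vec_lin.
  by rewrite linear_sum.
- have [n [e [Hew He]]] := Vfin b g.
  exists n, (f \o e); split=> [k|y Hy]; first exact: weight_vec_lin.
  have [x Hx ->] := lift _ _ _ Hy; have [c ->] := He _ Hx; exists c.
  by rewrite linear_sum; apply: eq_bigr => k _; rewrite linearZ.
- exists S => b g [y y0 Hy]; apply: (HS b); have [x Hx yE] := lift _ _ _ Hy.
  by exists x => //; apply: contraNneq y0 => x0; rewrite yE x0 linear0.
Qed.

End CategoryO.

(** * The radical of a highest l-weight module *)

Section HighestWeight.
Variables (K : fieldType) (q : K) (D : cartan_datum) (nu : coweight D).
Local Notation U := (uqaff q nu).
Local Notation "a %:U" := (uscalar q nu a) (at level 2, format "a %:U").
Hypothesis q0 : q != 0.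
Hypothesis qiV : forall i : D, qpar q i != (qpar q i)^-1.
Variable V : lmodType U.
Implicit Types (w : V) (u y : U) (c : K) (l : seq (D * int)).

Lemma uscalarCA c u w : u *: (c%:U *: w) = c%:U *: (u *: w).
Proof. by rewrite !scalerA uscalarC. Qed.

Lemma stable_subalg (P : V -> Prop) :
  (forall c w, P w -> P (c%:U *: w)) -> (forall w w', P w -> P w' -> P (w + w')) ->
  uq_subalg (fun u => forall w, P w -> P (u *: w)).
Proof.
move=> PZ PD; split=> [c w|u u' Hu Hu' w Pw|u u' Hu Hu' w Pw]; first exact: PZ.
  by rewrite scalerDl; apply: PD; [exact: Hu | exact: Hu'].
by rewrite -scalerA; apply: Hu; exact: Hu'.
Qed.

(** In general this is only a subspace, since x^+ can lead back to the highest l-weight vector;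
    hence the passage to [max_pred]. *)
Inductive lowered : V -> Prop :=
| Lowered0 : lowered 0
| LoweredX j r w : lowered (ux q nu false j r *: w)
| LoweredD w w' : lowered w -> lowered w' -> lowered (w + w').

Lemma loweredZ c w : lowered w -> lowered (c%:U *: w).
Proof.
elim=> {w} [|j r w|w w' _ IH _ IH']; first by rewrite scaler0; exact: Lowered0.
  by rewrite -uscalarCA; exact: LoweredX.
by rewrite scalerDr; exact: LoweredD.
Qed.

(* The largest submodule contained in [lowered]. *)
Definition max_pred : {pred V} := fun w => `[< forall u, lowered (u *: w) >].

Lemma max_submod_closed : submod_closed max_pred.
Proof.
split=> [|a w w' /asboolP Hw /asboolP Hw']; apply/asboolP => u.
  by rewrite scaler0; exact: Lowered0.
by rewrite scalerDr scalerA; exact: LoweredD.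
Qed.

Variable v : V.
Hypotheses (v0 : v != 0) (v_gen : forall w, exists u, w = u *: v).
Hypothesis v_x : forall j r, ux q nu true j r *: v = 0.
Hypothesis v_phi : forall b j r, exists c, uphi q nu b j r *: v = c%:U *: v.
(** The product is the ratio between the phi^+_(i,0)-eigenvalues of [word l] and of [v]. The
    hypothesis is discharged by [word_weight_neq1]. *)
Hypothesis shift_neq1 : forall l, l != [::] ->
  exists i, \prod_(p <- l) qpar q i ^ (- dmat i p.1) != 1.

(** The elements having [v] as an eigenvector form a subalgebra. It contains the inverses of the
    leading coefficients, whose eigenvalues cannot be 0, and therefore the h_(i,m). *)
Lemma v_cartan y : cartan_gen y -> exists c, y *: v = c%:U *: v.
Proof.
have HV b i : exists c, uphiV q nu b i *: v = c%:U *: v.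
  have [c Hc] := v_phi b i (lead nu b i).
  have c0 : c != 0.
    apply: contraNneq v0 => c0.
    by rewrite -[v]scale1r -(uphiVK q nu b i) -scalerA Hc c0 uscalar0 scale0r scaler0.
  exists c^-1; rewrite -[LHS]scale1r -(uscalarVK q nu c0) -scalerA -[c%:U *: _]uscalarCA.
  by rewrite -Hc [uphiV q nu b i *: _]scalerA uphiVK scale1r.
case=> [b i|b i|i m _]; [exact: v_phi | exact: HV |].
apply: (uh_closed (Q := fun u => exists c, u *: v = c%:U *: v)) => //.
split=> [a|u u' [c Hc] [c' Hc']|u u' [c Hc] [c' Hc']]; first by exists a.
  by exists (c + c'); rewrite scalerDl Hc Hc' uscalarD scalerDl.
by exists (c * c'); rewrite -scalerA Hc' uscalarCA Hc scalerA -uscalarM mulrC.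
Qed.

Definition word l : V := foldr (fun p w => ux q nu false p.1 p.2 *: w) v l.

Inductive wspan : V -> Prop :=
| WspanW l : wspan (word l)
| WspanZ c w : wspan w -> wspan (c%:U *: w)
| WspanD w w' : wspan w -> wspan w' -> wspan (w + w').

Lemma wspan0 : wspan 0.
Proof. by rewrite -(scale0r v) -uscalar0; apply: WspanZ; exact: (WspanW [::]). Qed.

Lemma wspan_stable u : (forall l, wspan (u *: word l)) ->
  forall w, wspan w -> wspan (u *: w).
Proof.
move=> Hu w; elim=> {w} [l|c w _ IH|w w' _ IH _ IH']; first exact: Hu.
  by rewrite uscalarCA; exact: WspanZ.
by rewrite scalerDr; exact: WspanD.
Qed.

Lemma wspan_xN j r w : wspan w -> wspan (ux q nu false j r *: w).
Proof. by apply: wspan_stable => l; exact: (WspanW ((j, r) :: l)). Qed.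

Lemma wspan_cartan y w : cartan_gen y -> wspan w -> wspan (y *: w).
Proof.
move=> Hy; apply: wspan_stable; elim=> [|[j r] l IH] /=.
  by have [c ->] := v_cartan Hy; apply: WspanZ; exact: (WspanW [::]).
have [c [d [s E]]] := cartan_gen_x q0 false j r Hy.
rewrite scalerA E scalerDl -!scalerA; apply: WspanD; apply: WspanZ; apply: wspan_xN => //.
exact: WspanW.
Qed.

Lemma wspan_phi b i r w : wspan w -> wspan (uphi q nu b i r *: w).
Proof.
move: w; apply: (uphi_closed qiV (Q := fun u => forall w, wspan w -> wspan (u *: w))) => //.
  by apply: stable_subalg; [exact: WspanZ | exact: WspanD].
by move=> y Hy w; exact: wspan_cartan.
Qed.

(** Straightening: x^+ either passes the first letter or leaves phi's acting on a shorter word, and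
    it kills [v]. *)
Lemma wspan_xP i r w : wspan w -> wspan (ux q nu true i r *: w).
Proof.
apply: wspan_stable; elim=> [|[j s] l IH] /=; first by rewrite v_x; exact: wspan0.
rewrite scalerA ux_comm // scalerDl -!scalerA; apply: WspanD; first exact: wspan_xN.
apply: WspanZ; rewrite scalerBl -scaleN1r -uscalar1 -uscalarN.
apply: WspanD; last apply: WspanZ; apply: wspan_phi; exact: WspanW.
Qed.

(** The module form of the triangular decomposition, U v = U^- v: the span of the words contains [v]
    and is stable under generators of U. *)
Lemma wspanT w : wspan w.
Proof.
have [u ->] := v_gen w; suff: forall w, wspan w -> wspan (u *: w) by apply; exact: (WspanW [::]).
move: {w} u.
apply: (uq_cartan_ind qiV (Q := fun u => forall w, wspan w -> wspan (u *: w))) => //.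
- by apply: stable_subalg; [exact: WspanZ | exact: WspanD].
- by case=> j r w; [exact: wspan_xP | exact: wspan_xN].
- by move=> y Hy w; exact: wspan_cartan.
Qed.

Lemma hw_decomp w : exists c w', lowered w' /\ w = c%:U *: v + w'.
Proof.
elim: (wspanT w) => {w} [[|p l]|c w _ [d [w' [Hw' ->]]]|
    w1 w2 _ [c [w1' [H1 ->]]] _ [d [w2' [H2 ->]]]].
- by exists 1, 0; rewrite uscalar1 scale1r addr0; split=> //; exact: Lowered0.
- exists 0, (word (p :: l)); rewrite uscalar0 scale0r add0r; split=> //.
  exact: LoweredX.
- exists (c * d), (c%:U *: w'); rewrite scalerDr scalerA -uscalarM; split=> //.
  exact: loweredZ.
- exists (c + d), (w1' + w2'); rewrite addrACA uscalarD -scalerDl; split=> //.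
  exact: LoweredD.
Qed.

(** By [wspanT], x^- is applied to sums of words, and prefixing a letter makes words nonempty. This
    presents lowered vectors as sums of eigenvectors. *)
Lemma lowered_words w : lowered w -> exists2 s : seq (K * seq (D * int)),
  all (fun p => p.2 != [::]) s & w = \sum_(p <- s) p.1%:U *: word p.2.
Proof.
have xw j r w' : wspan w' -> exists2 s : seq (K * seq (D * int)),
    all (fun p => p.2 != [::]) s &
    ux q nu false j r *: w' = \sum_(p <- s) p.1%:U *: word p.2.
  elim=> {w'} [l|c w' _ [s Hs E]|w1 w2 _ [s1 H1 E1] _ [s2 H2 E2]].
  - by exists [:: (1, (j, r) :: l)]; rewrite // big_seq1 uscalar1 scale1r.
  - exists [seq (c * p.1, p.2) | p <- s]; first by rewrite all_map.
    rewrite uscalarCA E scaler_sumr big_map; apply: eq_bigr => p _.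
    by rewrite scalerA -uscalarM.
  - by exists (s1 ++ s2); rewrite ?all_cat ?H1 ?H2 // scalerDr E1 E2 big_cat.
elim=> {w} [|j r w|w1 w2 _ [s1 H1 ->] _ [s2 H2 ->]].
- by exists [::]; rewrite ?big_nil.
- by apply: xw; exact: wspanT.
- by exists (s1 ++ s2); rewrite ?all_cat ?H1 ?H2 // big_cat.
Qed.

(** [v] and the words are joint eigenvectors of the phi^+_(i,0), and [shift_neq1] separates [v] from
    nonempty words, so [eigen_component] isolates the multiple of [v]. *)
Lemma hw_component (N : {pred V}) c w : submod_closed N -> lowered w ->
  c%:U *: v + w \in N -> c%:U *: v \in N.
Proof.
move=> HN /lowered_words[s /allP Hs ->] Ncv.
have /choice[g0 Hg0] i : exists g0, uphi0 q nu true i *: v = g0%:U *: v.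
  by apply: v_cartan; exact: CartanPhi.
have g0_neq0 i : g0 i != 0.
  apply: contraNneq v0 => g0i; rewrite -[v]scale1r -(uphiVK q nu true i) -scalerA.
  by rewrite Hg0 g0i uscalar0 scale0r scaler0.
pose g l i := g0 i * \prod_(p <- l) qpar q i ^ (- dmat i p.1).
have Hg l : eigen (uphi0 q nu true) (g l) (word l).
  elim: l => [|[j r] l IH] i /=; first by rewrite /g big_nil mulr1 Hg0.
  rewrite scalerA uphi0_x // -!scalerA IH uscalarCA !scalerA -uscalarM.
  by rewrite /g big_cons mulrCA mul1r mulN1r.
apply: (eigen_component (t := uphi0 q nu true) (g0 := g0) (g := fun p => g p.2) HN _ _ _ Ncv).
- exact: eigenZ.
- by move=> p _; apply: eigenZ; exact: Hg.
- move=> p /Hs /shift_neq1[i Hi]; exists i.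
  by rewrite -[X in _ != X]mulr1 (inj_eq (mulfI (g0_neq0 i))).
Qed.

(** For [w] in [N], the multiple of [v] occurring in [u *: w] lies in [N], so its coefficient is 0
    and [u *: w] is lowered. *)
Lemma max_pred_maximal (N : {pred V}) : submod_closed N -> v \notin N ->
  {subset N <= max_pred}.
Proof.
move=> HN vN w Nw; apply/asboolP => u.
have Nuw := submodZ HN u Nw; have [c [w' [Hw' E]]] := hw_decomp (u *: w).
rewrite E in Nuw *; have cv := hw_component HN Hw' Nuw.
have [->|c0] := eqVneq c 0; first by rewrite uscalar0 scale0r add0r.
by rewrite (scaler_uscalar_mem HN c0 cv) in vN.
Qed.

Lemma max_pred_proper : v \notin max_pred.
Proof.
apply/negP => /asboolP /(_ 1); rewrite scale1r => vlow.
(* If [v] were lowered, [v + (- v) = 0] would place [v] in the zero submodule. *)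
have := hw_component (c := 1) (zero_submod_closed V) (loweredZ (-1) vlow).
rewrite uscalarN uscalar1 scaleN1r scale1r subrr => /(_ (eqxx _)).
by move: v0 => /negPf; rewrite unfold_in => ->.
Qed.

Lemma hw_rad : rad_pred (V := V) =i max_pred.
Proof.
apply: rad_predE; first exact: max_submod_closed.
  by exists v; exact: max_pred_proper.
move=> N HN [w Nw]; apply: max_pred_maximal => //; apply: contra Nw => vN.
by have [u ->] := v_gen w; exact: submodZ.
Qed.

End HighestWeight.

(** * Inflations *)

Lemma mem_rad (R : pzRingType) (V : lmodType R) (v : V) : (v \in rad_pred (V := V)) = rad_pred v.
Proof. by []. Qed.

(** * Isomorphisms induced on radicals and tops *)

Section RadTop.
Variables (R S : pzRingType) (h : {rmorphism R -> S}).
Variables (V : lmodType S) (W : lmodType R) (f : {linear restr h V -> W}).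
(** [f] is linear over [R] only, whereas the radical of [V] is taken over [S], so bijectivity of [f]
    alone does not give this; see [inflation_rad]. *)
Hypothesis f_rad : forall v : V, rad_pred (f v) = rad_pred v.

Fact rad_map_subproof (x : mod_rad V) : rad_pred (f (val x)).
Proof. by rewrite f_rad; exact: valP x. Qed.

Definition rad_map (x : restr h (mod_rad V)) : mod_rad W :=
  exist _ (f (val (x : mod_rad V))) (rad_map_subproof x).

Fact rad_map_linear : linear rad_map.
Proof. by move=> a x y; apply: val_inj; exact: (linearP f). Qed.

HB.instance Definition _ := GRing.isLinear.Build R (restr h (mod_rad V)) (mod_rad W)
  _ rad_map rad_map_linear.

Lemma rad_map_bij : bijective f -> bijective rad_map.
Proof.
case=> g fK gK.
have g_rad w : rad_pred w -> rad_pred (g w : V) by rewrite -f_rad gK.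
exists (fun y => exist _ (g (val y) : V) (g_rad _ (valP y))) => x; apply: val_inj.
  exact: fK.
exact: gK.
Qed.

Definition top_map (x : restr h (mod_top V)) : mod_top W :=
  top_pi (f (repr (x : mod_top V))).

Lemma top_mapE (v : V) : top_map (top_pi v) = top_pi (f v).
Proof.
apply/top_piP; rewrite -(linearB f) mem_rad f_rad; apply/top_piP.
by rewrite /top_pi reprK.
Qed.

Fact top_map_linear : linear top_map.
Proof.
move=> a x y; have [u ->] := top_pi_surj x; have [v ->] := top_pi_surj y.
have -> : a *: (top_pi u : restr h (mod_top V)) + top_pi v = top_pi (h a *: u + v).
  by rewrite linearP.
by rewrite !top_mapE -linearP -(linearP f).
Qed.

HB.instance Definition _ := GRing.isLinear.Build R (restr h (mod_top V)) (mod_top W)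
  _ top_map top_map_linear.

(* [top_map] does not mention [f_rad], so that its linear structure alone
   cannot be inferred from it. *)
Definition top_linear : {linear restr h (mod_top V) -> mod_top W} := top_map.

Lemma top_linear_bij : bijective f -> bijective top_linear.
Proof.
case=> g fK gK; exists (fun y => top_pi (g (repr y) : V)) => x.
  have [v ->] := top_pi_surj x; rewrite /= top_mapE; apply/top_piP.
  rewrite mem_rad -f_rad (linearB f) gK; apply/top_piP.
  by rewrite /top_pi reprK.
by have [w ->] := top_pi_surj x; rewrite /= top_mapE gK /top_pi reprK.
Qed.

End RadTop.

(** * The radical of an inflation *)

Section Inflation.
Variables (K : fieldType) (q : K) (D : cartan_datum) (J : {set D}).
Variables (nu : coweight (subdatum J)) (mu : coweight D).
Variable res_mu : res_coweight J mu = nu.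
Local Notation UJ := (uqaff q nu).
Local Notation U := (uqaff q mu).
Local Notation incl := (uq_incl (q := q) res_mu).
Hypothesis q0 : q != 0.
Hypothesis qiV : forall i : D, qpar q i != (qpar q i)^-1.

Lemma uq_incl_x b j r : incl (ux q nu b j r) = ux q mu b (val j) r.
Proof. by rewrite /ux uq_incl_pi free_incl_x. Qed.

Lemma uq_incl_phi b j r : incl (uphi q nu b j r) = uphi q mu b (val j) r.
Proof. by rewrite /uphi uq_incl_pi free_incl_phi. Qed.

Lemma uq_incl_phiV b j : incl (uphiV q nu b j) = uphiV q mu b (val j).
Proof. by rewrite /uphiV uq_incl_pi free_incl_phiV. Qed.

Lemma uq_incl_scalar a : incl (uscalar q nu a) = uscalar q mu a.
Proof. by rewrite /uscalar uq_incl_pi free_inclZ free_incl1. Qed.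

(** The elements [u] with this property form a subalgebra, so generators suffice. The index of [y]
    may lie outside [J]. *)
Lemma cartan_gen_normal (y : U) (u : UJ) : cartan_gen y ->
  exists u' u'', incl u * y = y * incl u' + incl u''.
Proof.
move=> Hy; move: u.
apply: (uq_ind (Q := fun u => exists u' u'', incl u * y = y * incl u' + incl u'')).
- split=> [a|u v [u' [u'' Hu]] [v' [v'' Hv]]|u v [u' [u'' Hu]] [v' [v'' Hv]]].
  + exists (uscalar q nu a), 0.
    by rewrite raddf0 addr0 uq_incl_scalar uscalarC.
  + exists (u' + v'), (u'' + v'').
    by rewrite !raddfD mulrDl Hu Hv mulrDr addrACA.
  + exists (u' * v'), (u'' * v' + u * v'').
    by rewrite raddfD /= !rmorphM /= -mulrA Hv mulrDr mulrA Hu mulrDl !mulrA addrA.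
- move=> b j r; have [c [d [s E]]] := x_cartan_gen q0 b (val j) r Hy.
  exists (uscalar q nu c * ux q nu b j r), (uscalar q nu d * ux q nu b j s).
  by rewrite !rmorphM /= !uq_incl_x !uq_incl_scalar E !mulrA uscalarC.
- move=> b j r; exists (uphi q nu b j r), 0; rewrite raddf0 addr0 uq_incl_phi.
  exact: cartan_gen_comm.
- move=> b j; exists (uphiV q nu b j), 0; rewrite raddf0 addr0 uq_incl_phiV.
  by apply: uphiV_comm; exact: cartan_gen_comm.
Qed.

Variables (W : lmodType UJ) (V : lmodType U) (f : {linear restr incl V -> W}).

Lemma inflation_scale u (v : V) : f (incl u *: v : V) = u *: f v.
Proof. exact: (linearZ_LR f u v). Qed.

Hypothesis f_bij : bijective f.
Hypothesis V_x : forall i b r (v : V), i \notin J -> ux q mu b i r *: v = 0.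

(** Moving [y] past x^-_(j,r) leaves some x^-_(j,s) leftmost in each summand, with the same [j] in
    [J]. *)
Lemma lowered_inflation (y : U) (v : V) : cartan_gen y ->
  lowered (f v) -> lowered (f (y *: v : V)).
Proof.
case: f_bij => g fK gK Hy Hv; rewrite -(fK v).
elim: Hv => [|j r w|w w' _ IH _ IH'].
- rewrite -(linear0 f) fK (scaler0 _ y) linear0; exact: Lowered0.
- have [c [d [s E]]] := cartan_gen_x q0 false (val j) r Hy.
  have -> : g (ux q nu false j r *: w) = (ux q mu false (val j) r *: (g w : V)).
    by apply: (can_inj fK); rewrite gK -uq_incl_x inflation_scale gK.
  rewrite scalerA E scalerDl -!scalerA -!uq_incl_scalar -!uq_incl_x.
  rewrite (linearD f) !inflation_scale.
  by apply: LoweredD; apply: loweredZ; exact: LoweredX.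
- have -> : g (w + w') = g w + g w' by apply: (can_inj fK); rewrite linearD !gK.
  by rewrite (scalerDr y (g w : V)) (linearD f); exact: LoweredD.
Qed.

Definition inflation_pred : {pred V} := fun v => f v \in max_pred (V := W).

Lemma inflation_pred_closed : submod_closed inflation_pred.
Proof.
have [M0 MD] := max_submod_closed W.
have PD v v' : inflation_pred v -> inflation_pred v' -> inflation_pred (v + v').
  rewrite /inflation_pred (linearD f); exact: (submodD (max_submod_closed W)).
have PZ c v : inflation_pred v -> inflation_pred (uscalar q mu c *: v).
  rewrite /inflation_pred -uq_incl_scalar inflation_scale.
  exact: (submodZ (max_submod_closed W)).
suff PU u v : inflation_pred v -> inflation_pred (u *: v).
  split=> [|a v v' Hv Hv']; first by rewrite unfold_in /inflation_pred linear0.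
  by apply: PD => //; exact: PU.
move: u v; apply: (uq_cartan_ind qiV
  (Q := fun u => forall v, inflation_pred v -> inflation_pred (u *: v))).
- by apply: stable_subalg.
- move=> b i r v Hv; have [iJ|iJ] := boolP (i \in J); last first.
    by rewrite V_x // /inflation_pred linear0.
  have -> : ux q mu b i r = incl (ux q nu b (exist _ i iJ) r) by rewrite uq_incl_x.
  by rewrite /inflation_pred inflation_scale (submodZ (max_submod_closed W)).
(* Since u y v = y u' v + u'' v, and both u' v and u'' v are lowered, it remains that [y] preserves
   lowered vectors. *)
- move=> y Hy v /asboolP Hv; apply/asboolP => u.
  have [u' [u'' E]] := cartan_gen_normal u Hy.
  rewrite -inflation_scale scalerA E scalerDl (linearD f) -scalerA.
  apply: LoweredD; last by rewrite inflation_scale.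
  by apply: lowered_inflation => //; rewrite inflation_scale.
Qed.

Hypothesis shift_neq1 : forall l : seq (subdatum J * int), l != [::] ->
  exists i, \prod_(p <- l) qpar q i ^ (- dmat i p.1) != 1.

Lemma inflation_rad : highest_lweight W ->
  forall v : V, rad_pred (f v) = rad_pred v.
Proof.
case=> _ [Psi [v0 [v0_neq0 v0_gen v0_x _ v0_Psi]]] v.
have v0_phi b j r : exists c, uphi q nu b j r *: v0 = uscalar q nu c *: v0.
  by have [c _ Hc] := v0_Psi b j; exists (c r).
have qiVJ (i : subdatum J) : qpar q i != (qpar q i)^-1 by exact: qiV (val i).
case: f_bij => g fK gK.
have gZ u w : g (u *: w) = incl u *: (g w : V).
  by apply: (can_inj fK); rewrite gK inflation_scale gK.
have gD w w' : g (w + w') = g w + g w'.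
  by apply: (can_inj fK); rewrite linearD !gK.
rewrite -[LHS]/(f v \in rad_pred (V := W)) -[RHS]/(v \in rad_pred (V := V)).
rewrite (hw_rad q0 qiVJ v0_neq0 v0_gen v0_x v0_phi shift_neq1).
apply: esym; apply: (rad_predE (N := inflation_pred)); first exact: inflation_pred_closed.
  exists (g v0); rewrite unfold_in /inflation_pred gK.
  exact: (max_pred_proper q0 qiVJ v0_neq0 v0_gen v0_x v0_phi shift_neq1).
move=> N HN [z Nz] x Nx.
(* A proper submodule of [V] becomes a submodule of [W] omitting [v0], since [v0] generates [W];
   maximality is thus inherited from [W]. *)
pose NW : {pred W} := fun w => (g w : V) \in N.
have HNW : submod_closed NW.
  split=> [|a w w' Hw Hw']; rewrite unfold_in /NW.
    by rewrite -(linear0 f) fK; exact: HN.1.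
  by rewrite gD gZ; exact: HN.2.
apply: (max_pred_maximal q0 qiVJ v0_neq0 v0_gen v0_x v0_phi shift_neq1 HNW).
  apply: contra Nz; rewrite unfold_in /NW => Nv0.
  have [u E] := v0_gen (f z); rewrite -(fK z) E gZ; exact: submodZ.
by rewrite unfold_in /NW fK.
Qed.

End Inflation.

(** * Weights of words when q is not a root of unity *)

Section NotRootOfUnity.
Variables (K : fieldType) (q : K).
Hypotheses (q0 : q != 0) (q_root : forall k : nat, (0 < k)%N -> q ^+ k != 1).

Lemma not_root_exprz (m : int) : q ^ m = 1 -> m = 0.
Proof.
case: m => [[|k]|k] // /eqP; first by rewrite -exprnP (negPf (q_root _)).
by rewrite NegzE -exprnN invr_eq1 (negPf (q_root _)).
Qed.

Lemma qpar_neqV (D : cartan_datum) (i : D) : (0 < dsym i)%N ->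
  qpar q i != (qpar q i)^-1.
Proof.
move=> di; rewrite -(inj_eq (mulIf (qpar_neq0 q0 i))) mulVf ?qpar_neq0 //.
by rewrite /qpar -exprD q_root // addn_gt0 di.
Qed.

(** Otherwise the vector [u] counting the letters of [l] is nonzero, supported on [J], and
    orthogonal to each simple root of [J]. The form then vanishes at [u], against positive
    definiteness. *)
Lemma word_weight_neq1 (R : realFieldType) n (A : 'M[int]_n) (d : 'I_n -> nat)
    (J : {set matrix_datum A d}) (l : seq (subdatum J * int)) :
  simple_cartan R A d -> l != [::] ->
  exists i, \prod_(p <- l) qpar q i ^ (- dmat i p.1) != 1.
Proof.
move=> HA l0; apply: contrapT => H.
(* The product in [H] is q to the power minus this sum, and q has infinite order. *)
have sum0 (i : subdatum J) : \sum_(p <- l) (d (val i))%:Z * A (val i) (val p.1) = 0.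
  apply/eqP; rewrite -oppr_eq0; apply/eqP/not_root_exprz.
  transitivity (\prod_(p <- l) qpar q i ^ (- dmat i p.1)); last first.
    by apply/eqP/negPn/negP => Hi; apply: H; exists i.
  elim: l {l0 H} => [|p l IH]; first by rewrite !big_nil oppr0 expr0z.
  rewrite !big_cons opprD expfzDr // IH; congr (_ * _).
  by rewrite /qpar /= exprnP exprz_exp mulrN.
pose u (j : 'I_n) : R := \sum_(p <- l) (val p.1 == j)%:R.
have uJ j : j \notin J -> u j = 0.
  move=> jJ; rewrite /u big1_seq // => p _.
  by case: eqP jJ => // <-; rewrite (valP p.1).
have u_neq0 : exists i, u i != 0.
  case: l l0 @u {uJ sum0 H} => // p l _ /=; exists (val p.1).
  rewrite big_cons eqxx gt_eqF // ltr_wpDr // sumr_ge0 // => ? _; exact: ler0n.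
have := cartan_posdef HA u_neq0.
(* Rows outside [J] vanish because [u i] does, the others by [sum0]. *)
rewrite big1 ?ltxx // => i _; have [iJ|/uJ ui0] := boolP (i \in J); last first.
  by rewrite big1 // => j _; rewrite ui0 !mul0r.
rewrite -[RHS](mulr0 (u i)) -[0 in RHS](rmorph0 (intmul 1)).
rewrite -(sum0 (exist _ i iJ)) rmorph_sum mulr_sumr.
under eq_bigr => j _ do rewrite [u j]/u mulr_sumr.
rewrite exchange_big /=; apply: eq_bigr => p _.
rewrite (bigD1 (val p.1)) //= eqxx mulr1 big1 ?addr0 // => j.
by rewrite eq_sym => /negPf ->; rewrite mulr0.
Qed.

End NotRootOfUnity.

Theorem proposition3p26 (R : realType)
  (n : nat) (A : 'M[int]_n) (d : 'I_n -> nat) (HA : simple_cartan R A d)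
  (q : R[i]) (q_neq0 : q != 0) (q_not_root : forall k : nat, (0 < k)%N -> q ^+ k != 1)
  (J : {set matrix_datum A d})
  (nu : coweight (subdatum J)) (W : lmodType (uqaff q nu))
  (HW : highest_lweight W)
  (mu : coweight (matrix_datum A d)) (res_mu : res_coweight J mu = nu)
  (V : lmodType (uqaff q mu)) (HV : is_inflation res_mu W V) :
  is_inflation res_mu (mod_rad W) (mod_rad V) /\
  is_inflation res_mu (mod_top W) (mod_top V).
Proof.
case: HV => OW OV [f f_bij] V_x.
have qiV (i : matrix_datum A d) : qpar q i != (qpar q i)^-1.
  by apply: qpar_neqV => //; exact: cartan_sym_gt0 HA i.
(* Through this identification of the radicals, [f] induces both isomorphisms below. *)
have f_rad := inflation_rad q_neq0 qiV f_bij V_x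
  (fun l l0 => word_weight_neq1 q_neq0 q_not_root HA l0) HW.
split; split.
- exact: (category_O_sub (f := val : {linear mod_rad W -> W}) val_inj).
- exact: (category_O_sub (f := val : {linear mod_rad V -> V}) val_inj).
- exists (rad_map f_rad); exact: rad_map_bij.
- by move=> i b r v iJ; apply: val_inj; rewrite linearZ /= V_x.
- exact: (category_O_quo (f := @top_pi _ W) (@top_pi_surj _ W)).
- exact: (category_O_quo (f := @top_pi _ V) (@top_pi_surj _ V)).
- exists (top_linear f_rad); exact: top_linear_bij.
- move=> i b r x iJ; have [v ->] := top_pi_surj x.
  by rewrite -linearZ V_x // linear0.
Qed.
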